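(* Let $\mathcal C\subseteq\mathbb C$ be a subfield and let $A\in\operatorname{GL}_d(\mathcal C(z))$. Let $\zeta\in\mathbb C$ be a pole of $A$ of order $\nu\ge1$ such that $\zeta-j$ is not a pole of $A$ for any positive integer $j$. Let $\tilde A=(z-\zeta)^\nu A$, so that $\tilde A(\zeta)\ne0$. If $\zeta$ is a removable r-singularity of the system $Y(z+1)=A(z)Y(z)$, then there exists a positive integer $k$ such that $$\tilde A(\zeta)A(\zeta-1)\cdots A(\zeta-k)=0.$$ In particular, the matrix $A(\zeta-j)$ is singular for some positive integer $j$.
   Context: A solution of the system is a $d$-dimensional column vector of functions satisfying $Y(z+1)=A(z)Y(z)$. A solution that is holomorphic in some left half-plane $\{\operatorname{Re} z<\lambda\}$, $\lambda\in\mathbb R$, can be continued to a meromorphic solution on $\mathbb C$ via $Y(z)=A(z-1)A(z-2)\cdots A(z-n)Y(z-n)$. A pole $\zeta$ of $A$ is called a removable r-singularity of the system if any solution which is holomorphic in some left half-plane can be analytically continued to a meromorphic solution which is holomorphic at $\zeta+1$. The order of the pole $\zeta$ of the matrix $A$ is the maximal order of the pole at $\zeta$ among its entries. *)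

(* Defs.v *)
From HB Require Import structures.
From mathcomp Require Import all_boot all_order all_algebra.
From mathcomp Require Import fraction generic_quotient complex.
From mathcomp Require Import boolp classical_sets reals topology normedtype derive.

Set Implicit Arguments.
Unset Strict Implicit.
Unset Printing Implicit Defensive.

Import Order.TTheory GRing.Theory Num.Theory.
Import numFieldNormedType.Exports.

Local Open Scope classical_set_scope.
Local Open Scope ring_scope.

Notation "x %:F" := (FracField.tofrac x) : ring_scope.

Section RationalFunctions.
Variable F : fieldType.
Implicit Types (f : {fraction {poly F}}) (z : F).

(* [repr f] is an arbitrary ratio representing [f], hence the division by the
   gcd; [rat_num f] and [rat_den f] are still only defined up to a common
   nonzero constant factor. *)
Definition rat_num f : {poly F} :=
  \n_(repr f) %/ gcdp \n_(repr f) \d_(repr f).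

Definition rat_den f : {poly F} :=
  \d_(repr f) %/ gcdp \n_(repr f) \d_(repr f).

(* The value is 0 at the poles of [f]. *)
Definition rat_eval f z : F := (rat_num f).[z] / (rat_den f).[z].

Definition rat_pole_order f z : nat := mup z (rat_den f).

Lemma rat_den_neq0 f : rat_den f != 0.
Proof.
have d0 : \d_(repr f) != 0 by apply: denom_ratioP.
by rewrite /rat_den dvdp_div_eq0 ?dvdp_gcdr.
Qed.

Lemma coprimep_rat_num_den f : coprimep (rat_num f) (rat_den f).
Proof.
have d0 : \d_(repr f) != 0 by apply: denom_ratioP.
by rewrite /rat_num /rat_den coprimep_div_gcd // d0 orbT.
Qed.

Lemma rat_num_den f : f = (rat_num f)%:F / (rat_den f)%:F.
Proof.
have d0 : \d_(repr f) != 0 by apply: denom_ratioP.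
have fE : f * (\d_(repr f))%:F = (\n_(repr f))%:F.
  rewrite -{1}[f]reprK; unlock FracField.tofrac.
  rewrite -[LHS]FracField.pi_mul; apply/eqmodP => /=.
  rewrite FracField.equivfE /FracField.mulf /=.
  by rewrite !numden_Ratio ?oner_eq0 ?mulr1 // mulrC.
have := rat_den_neq0 f; rewrite /rat_num /rat_den.
move: (\n_(repr f)) (\d_(repr f)) d0 fE => n e e0 fE.
have g0 : gcdp n e != 0 by rewrite gcdp_eq0 negb_and e0 orbT.
have /divpK nE := dvdp_gcdl n e; have /divpK eE := dvdp_gcdr n e.
move: (n %/ gcdp n e) (e %/ gcdp n e) (gcdp n e) g0 nE eE => a b g g0 nE eE b0.
rewrite -tofrac_eq0 in g0; rewrite -tofrac_eq0 in b0.
apply: (canRL (mulfK b0)); apply: (mulIf g0).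
by rewrite -mulrA -2!tofracM nE eE fE.
Qed.

Lemma rat_num_denP f (p q : {poly F}) : q != 0 ->
  f = p%:F / q%:F -> rat_num f * q = p * rat_den f.
Proof.
move=> q0 fE; have := rat_den_neq0 f; have := rat_num_den f.
move: (rat_num f) (rat_den f) => a b fE' b0.
rewrite -tofrac_eq0 in q0; rewrite -tofrac_eq0 in b0.
apply/eqP; rewrite -tofrac_eq; apply/eqP; rewrite 2!tofracM.
rewrite -(divfK b0 a%:F) -fE' -(divfK q0 p%:F) -fE.
by rewrite mulrAC.
Qed.

Lemma rat_eval_frac (p q : {poly F}) z : q.[z] != 0 ->
  rat_eval (p%:F / q%:F) z = p.[z] / q.[z].
Proof.
move=> qz; set f := _ / _.
have q0 : q != 0 by apply: contraNneq qz => ->; rewrite horner0.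
have E := rat_num_denP q0 (erefl f).
have dq : rat_den f %| q.
  have := dvdp_mull p (dvdpp (rat_den f)); rewrite -E.
  by rewrite Gauss_dvdpr // coprimep_sym coprimep_rat_num_den.
have dz : (rat_den f).[z] != 0.
  by apply: contraNneq qz => dz; rewrite -(divpK dq) hornerM dz mulr0.
by apply/eqP; rewrite eqr_div // -!hornerM E.
Qed.

Lemma rat_pole_order_frac (p q : {poly F}) z : q != 0 -> p.[z] != 0 ->
  rat_pole_order (p%:F / q%:F) z = mup z q.
Proof.
move=> q0 pz; rewrite /rat_pole_order; set f := _ / _.
have p0 : p != 0 by apply: contraNneq pz => ->; rewrite horner0.
have E := rat_num_denP q0 (erefl f).
have np : rat_num f %| p.
  have := dvdp_mulr q (dvdpp (rat_num f)); rewrite E.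
  by rewrite Gauss_dvdpl // coprimep_rat_num_den.
have nz : (rat_num f).[z] != 0.
  by apply: contraNneq pz => nz; rewrite -(divpK np) hornerM nz mulr0.
have := congr1 (mup z) E.
by rewrite mupMr ?mupMr.
Qed.

Variable d : nat.
Implicit Types A : 'M[{fraction {poly F}}]_d.

Definition mx_eval A z : 'M[F]_d := \matrix_(i, j) rat_eval (A i j) z.

Definition mx_pole_order A z : nat :=
  \max_(i < d) \max_(j < d) rat_pole_order (A i j) z.

Definition is_pole A z : Prop := (0 < mx_pole_order A z)%N.

(* (X - z)^nu A *)
Definition clear_pole A z (nu : nat) : 'M[{fraction {poly F}}]_d :=
  (('X - z%:P) ^+ nu)%:F *: A.

(* The field K(z) inside F(z), and GL_d(K(z)) inside the matrices over F(z); the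
   entries of the inverse of such a matrix are again in K(z) by Cramer's rule. *)
Definition rational_over (K : {pred F}) f : Prop :=
  exists p q : {poly F},
    [/\ p \is a polyOver K, q \is a polyOver K, q != 0 & f = p%:F / q%:F].

Definition GL_rational_over (K : {pred F}) A : Prop :=
  A \in unitmx /\ forall i j, rational_over K (A i j).

End RationalFunctions.

Section DifferenceSystems.
Variable R : realType.

(* [R[i]] carries its topology under the alias [R[i]^o]; being derivable in the
   direction 1 over the scalars [R[i]] is complex differentiability. *)
Definition holomorphic_at (f : R[i]^o -> R[i]^o) (z : R[i]^o) : Prop :=
  \forall w \near z, derivable f w 1.

(* Meromorphic functions are represented by total functions, whose values at
   the poles are irrelevant. *)
Definition meromorphic_at (f : R[i]^o -> R[i]^o) (z : R[i]^o) : Prop :=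
  exists (n : nat) (g : R[i]^o -> R[i]^o), holomorphic_at g z /\
    \forall w \near z^', f w = g w / (w - z) ^+ n.

Definition left_half_plane (lambda : R) : set R[i]^o :=
  [set z | complex.Re z < lambda].

Variable d : nat.
Implicit Types (A : 'M[{fraction {poly R[i]}}]_d) (Y Z : R[i] -> 'cV[R[i]]_d).

Definition vholomorphic_at Y (z : R[i]) : Prop :=
  forall i, holomorphic_at (fun w => Y w i 0) z.

Definition vmeromorphic_at Y (z : R[i]) : Prop :=
  forall i, meromorphic_at (fun w => Y w i 0) z.

(* Y(z+1) = A(z) Y(z) as an identity of meromorphic functions wherever both
   sides are defined: at every z with z and z+1 in D it is required on a
   punctured neighbourhood of z, so that poles of A and Y do not matter. *)
Definition solution_on (D : set R[i]^o) A Y : Prop :=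
  forall z : R[i]^o, D z -> D (z + 1) ->
    \forall w \near z^', Y (w + 1) = mx_eval A w *m Y w.

Definition removable_r_singularity A (zeta : R[i]) : Prop :=
  is_pole A zeta /\
  forall (lambda : R) Y,
    (forall z, left_half_plane lambda z -> vholomorphic_at Y z) ->
    solution_on (left_half_plane lambda) A Y ->
    exists Z, [/\ forall z, left_half_plane lambda z -> Z z = Y z,
                  forall z, vmeromorphic_at Z z,
                  solution_on setT A Z
                & vholomorphic_at Z (zeta + 1)].

End DifferenceSystems.

(* Main.v *)
(* On a half-plane Re z < lambda free of zeros and poles of A and det A, a solution
   taking any prescribed direction at c = zeta - k is given by a Poincare series
     sum_(n >= 0) A(z-1) ... A(z-n) phi(z-n)
       + sum_(n >= 1) A(z)^-1 ... A(z+n-1)^-1 phi(z+n),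
   where phi(z) = exp(-z^2) (z-c)^-L v: the products grow at most like a power of n!,
   and the Gaussian makes the series converge.  The poles coming from A^-1 to the
   right of the half-plane and from (z-c)^-L lie on finitely many translates of Z and
   have bounded order, hence are cleared by a periodic factor built from
   exp(2 pi i z) - 1; for L the order of vanishing of that factor at c, the only term
   surviving at c is phi itself, so that the value there is a nonzero multiple of v.
   If every solution Y extends holomorphically to zeta + 1, multiplying
     Y(z+1) = A(z) A(z-1) ... A(z-k) Y(z-k)
   by (z-zeta)^nu and letting z tend to zeta shows that the product in question kills
   every v. *)
Require Import Defs.
From HB Require Import structures.
From mathcomp Require Import all_boot all_order all_algebra.
From mathcomp Require Import fraction complex reals.
From mathcomp Require Import ring lra zify.
From mathcomp Require Import boolp classical_sets topology normedtype derive.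
From mathcomp Require Import sequences exp trigo.

Set Implicit Arguments.
Unset Strict Implicit.
Unset Printing Implicit Defensive.

Import Order.TTheory GRing.Theory Num.Theory.
Import numFieldNormedType.Exports.

Local Open Scope classical_set_scope.
Local Open Scope ring_scope.

(** The solution is needed at every point of the half-plane, including those where single terms of
    the series have poles and the convention [0^-1 = 0] makes the formula meaningless. Around each
    [z0] the zero of the periodic factor is therefore split off as a power of (z - z0) and handed to
    the terms, where it cancels their poles one by one; the regular terms are then summed on a disc
    around [z0]. One exponent has to do this for all n, so it matters that the poles of phi and
    those of the products of inverses never pile up at the same point. The local sums agree off
    their centers, and the solution takes at each point the value of the sum centered there. The
    series is bilateral because the left half alone satisfies the equation with the defect phi(z+1)
    v, and the half over n >= 1 with the opposite defect. The half-plane depends on A only, so one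
    [k] serves all vectors v; this is what turns the vanishing on every v into the vanishing of a
    single matrix product. *)

Local Notation nm := Normc.normc.

(** * Norm and geometric sums of complex numbers *)

Section Norm.
Variable R : realType.
Implicit Types x y z w : R[i].

Lemma normE z : `|z| = (nm z)%:C%C. Proof. by []. Qed.

Lemma nm_ge0 z : 0 <= nm z.
Proof. by case: z => a b /=; rewrite sqrtr_ge0. Qed.

Lemma nm0 : nm (0 : R[i]) = 0. Proof. exact: Normc.normc0. Qed.
Lemma nm1 : nm (1 : R[i]) = 1. Proof. exact: Normc.normc1. Qed.
Lemma nmN z : nm (- z) = nm z. Proof. exact: normcN. Qed.
Lemma nmM x y : nm (x * y) = nm x * nm y. Proof. exact: Normc.normcM. Qed.
Lemma nmV x : nm x^-1 = (nm x)^-1. Proof. exact: Normc.normcV. Qed.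
Lemma nmD x y : nm (x + y) <= nm x + nm y. Proof. exact: le_normcD. Qed.
Lemma nmB x y : nm (x - y) <= nm x + nm y.
Proof. by rewrite -(nmN y) nmD. Qed.
Lemma nmBC x y : nm (x - y) = nm (y - x).
Proof. by rewrite -nmN opprB. Qed.
Lemma nm_eq0 z : (nm z == 0) = (z == 0).
Proof. by apply/eqP/eqP => [/Normc.eq0_normc//|->]; rewrite nm0. Qed.
Lemma nmX z n : nm (z ^+ n) = nm z ^+ n.
Proof. by elim: n => [|n IH]; rewrite ?expr0 ?nm1 // !exprS nmM IH. Qed.

Lemma nm_real (a : R) : nm (a%:C)%C = `|a|.
Proof. by rewrite /= expr0n addr0 sqrtr_sqr. Qed.

Lemma nm_nat n : nm (n%:R : R[i]) = n%:R.
Proof.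
have -> : (n%:R : R[i]) = (n%:R%:C)%C by rewrite rmorph_nat.
by rewrite nm_real normr_nat.
Qed.

Lemma nm_gt0 z : (0 < nm z) = (z != 0).
Proof. by rewrite lt_def nm_ge0 nm_eq0 andbT. Qed.

Lemma Re_le_nm z : `|complex.Re z| <= nm z.
Proof.
by case: z => a b /=; rewrite -sqrtr_sqr ler_wsqrtr // lerDl sqr_ge0.
Qed.

Lemma Im_le_nm z : `|complex.Im z| <= nm z.
Proof.
by case: z => a b /=; rewrite -sqrtr_sqr ler_wsqrtr // lerDr sqr_ge0.
Qed.

Lemma nm_le_ReIm z : nm z <= `|complex.Re z| + `|complex.Im z|.
Proof.
case: z => a b; have -> : (a +i* b)%C = (a%:C)%C + (0 +i* b)%C.
  by apply/eqP; rewrite eq_complex /= addr0 add0r !eqxx.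
by rewrite (le_trans (nmD _ _)) //= !expr0n /= !addr0 !add0r !sqrtr_sqr.
Qed.

Lemma nm_sum I (r : seq I) (F : I -> R[i]) :
  nm (\sum_(i <- r) F i) <= \sum_(i <- r) nm (F i).
Proof.
elim/big_ind2: _ => [|x y x' y' ? ?|//]; first by rewrite nm0.
by rewrite (le_trans (nmD _ _)) ?lerD.
Qed.

Lemma ReD x y : complex.Re (x + y) = complex.Re x + complex.Re y.
Proof. by case: x y => a b [c e]. Qed.
Lemma ImD x y : complex.Im (x + y) = complex.Im x + complex.Im y.
Proof. by case: x y => a b [c e]. Qed.
Lemma ReN x : complex.Re (- x) = - complex.Re x.
Proof. by case: x. Qed.
Lemma ImN x : complex.Im (- x) = - complex.Im x.
Proof. by case: x. Qed.
Lemma Re_sum I (r : seq I) (F : I -> R[i]) :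
  complex.Re (\sum_(i <- r) F i) = \sum_(i <- r) complex.Re (F i).
Proof. by apply: (big_morph _ ReD). Qed.
Lemma Im_sum I (r : seq I) (F : I -> R[i]) :
  complex.Im (\sum_(i <- r) F i) = \sum_(i <- r) complex.Im (F i).
Proof. by apply: (big_morph _ ImD). Qed.
Lemma Re_nat n : complex.Re (n%:R : R[i]) = n%:R.
Proof. by rewrite -(rmorph_nat (real_complex R)). Qed.

End Norm.

Section GeometricSums.
Variable R : realType.
Implicit Types (u v : nat -> R[i]) (s t : R[i]).

(** Replaces passages to the limit: uniqueness of sums, bounds on sums and equality of two
    continuous functions at a point all end here. *)
Lemma le_geom (a b : R) (h : forall N : nat, a <= b / 2 ^+ N) : a <= 0.
Proof.
rewrite leNgt; apply/negP => a0.
have [N] : exists N : nat, b / a < 2 ^+ N.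
  exists (Num.truncn (b / a)).+1.
  have /lt_trans -> // : b / a < (Num.truncn (b / a)).+1%:R by rewrite truncnS_gt.
  by rewrite -natrX ltr_nat ltn_expl.
rewrite ltr_pdivrMr // mulrC -ltr_pdivrMr ?exprn_gt0 //.
by rewrite ltNge h.
Qed.

Lemma sum_geom (K : R) (m n : nat) : 0 <= K -> (m <= n)%N ->
  \sum_(m <= k < n) K / 2 ^+ k <= 2 * K / 2 ^+ m.
Proof.
move=> K0 mn.
have -> : \sum_(m <= k < n) K / 2 ^+ k = 2 * K / 2 ^+ m - 2 * K / 2 ^+ n.
  elim: n mn => [|n IH]; first by rewrite leqn0 => /eqP ->; rewrite big_geq ?subrr.
  rewrite leq_eqVlt => /orP[/eqP->|]; first by rewrite big_geq ?subrr.
  rewrite ltnS => mn; rewrite big_nat_recr //= IH // exprS.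
  have : (2 : R) ^+ n != 0 by rewrite expf_neq0 ?pnatr_eq0.
  have : (2 : R) ^+ m != 0 by rewrite expf_neq0 ?pnatr_eq0.
  by move=> h1 h2; field; rewrite h1 h2.
by rewrite gerBl divr_ge0 ?mulr_ge0 ?exprn_ge0.
Qed.

Lemma real_geom_sum (a : nat -> R) (K : R) :
  (forall k, `|a k| <= K / 2 ^+ k) ->
  forall N, `|limn (series a) - series a N| <= 2 * K / 2 ^+ N.
Proof.
move=> aK N; have K0 : 0 <= K.
  by have := aK 0%N; rewrite expr0 divr1; apply: le_trans.
have tail n : (N <= n)%N -> `|series a n - series a N| <= 2 * K / 2 ^+ N.
  move=> Nn; rewrite /series /= (big_cat_nat (n := N)) //= addrAC subrr add0r.
  by rewrite (le_trans (ler_norm_sum _ _ _)) // (le_trans _ (sum_geom K0 Nn)) ?ler_sum.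
have cv : cvgn (series a).
  apply: normed_cvg; apply: (series_le_cvg (v_ := geometric K 2^-1)).
  - by move=> n /=.
  - by move=> n /=; rewrite mulr_ge0 ?exprn_ge0 ?invr_ge0.
  - by move=> n /=; rewrite exprVn.
  - by apply: is_cvg_geometric_series; rewrite ger0_norm ?invf_lt1 ?ltr1n ?invr_ge0.
have le1 : limn (series a) <= series a N + 2 * K / 2 ^+ N.
  apply: limr_le => //; exists N => // n /= /tail.
  by rewrite ler_distl => /andP[].
have le2 : series a N - 2 * K / 2 ^+ N <= limn (series a).
  apply: limr_ge => //; exists N => // n /= /tail.
  by rewrite ler_distl => /andP[].
by rewrite ler_distl le1 le2.
Qed.

(** Real and imaginary parts are summed separately, so that convergence is that of real series; for
    a divergent series the value means nothing. *)
Definition csum u : R[i] :=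
  (limn (series (fun k => complex.Re (u k)))
   +i* limn (series (fun k => complex.Im (u k))))%C.

(** Convergence with an explicit geometric rate. Sums, shifts and scalings only change [K], so no
    limit has to be manipulated. *)
Definition gsum u s (K : R) :=
  forall N : nat, nm (s - \sum_(k < N) u k) <= K / 2 ^+ N.

Lemma csum_gsum u (K : R) : (forall k, nm (u k) <= K / 2 ^+ k) ->
  gsum u (csum u) (4 * K).
Proof.
move=> uK N; rewrite (le_trans (nm_le_ReIm _)) // !ReD !ImD ReN ImN /=.
rewrite Re_sum Im_sum.
have /real_geom_sum/(_ N) h1 : forall k, `|complex.Re (u k)| <= K / 2 ^+ k.
  by move=> k; apply: le_trans (Re_le_nm _) _.
have /real_geom_sum/(_ N) h2 : forall k, `|complex.Im (u k)| <= K / 2 ^+ k.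
  by move=> k; apply: le_trans (Im_le_nm _) _.
rewrite /series /= !big_mkord in h1 h2.
have -> : 4 * K / 2 ^+ N = 2 * K / 2 ^+ N + 2 * K / 2 ^+ N by ring.
exact: lerD.
Qed.

Lemma gsum_uniq u s t K L : gsum u s K -> gsum u t L -> s = t.
Proof.
move=> us ut; apply/eqP; rewrite -subr_eq0 -nm_eq0 eq_le nm_ge0 andbT.
apply: (@le_geom _ (K + L)) => N.
rewrite mulrDl (le_trans _ (lerD (us N) (ut N))) //.
rewrite [nm (t - _)]nmBC (le_trans _ (nmD _ _)) //.
by rewrite le_eqVlt; apply/orP; left; apply/eqP; congr nm; ring.
Qed.

Lemma gsumD u v s t K L : gsum u s K -> gsum v t L ->
  gsum (fun k => u k + v k) (s + t) (K + L).
Proof.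
move=> us vt N; rewrite big_split /= mulrDl (le_trans _ (lerD (us N) (vt N))) //.
rewrite (le_trans _ (nmD _ _)) //.
by rewrite le_eqVlt; apply/orP; left; apply/eqP; congr nm; ring.
Qed.

Lemma gsumZ u s K a : gsum u s K -> gsum (fun k => a * u k) (a * s) (nm a * K).
Proof.
move=> us N; rewrite -mulr_sumr -mulrBr nmM -mulrA.
by rewrite ler_wpM2l ?nm_ge0.
Qed.

Lemma gsum_sum (I : Type) (r : seq I) (u : I -> nat -> R[i]) (s : I -> R[i])
    (K : I -> R) : (forall i, gsum (u i) (s i) (K i)) ->
  gsum (fun k => \sum_(i <- r) u i k) (\sum_(i <- r) s i) (\sum_(i <- r) K i).
Proof.
move=> h; elim: r => [|i r IH] N.
  by rewrite !big_nil mul0r big1 ?subrr ?nm0 // => k _; rewrite big_nil.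
have -> : \sum_(k < N) \sum_(j <- i :: r) u j k =
          \sum_(k < N) (u i k + \sum_(j <- r) u j k).
  by apply: eq_bigr => k _; rewrite big_cons.
by rewrite !big_cons; exact: (gsumD (h i) IH).
Qed.

Lemma gsumS u s K : gsum u s K -> gsum (fun k => u k.+1) (s - u 0%N) K.
Proof.
move=> us N; have K0 : 0 <= K.
  by have := us 0%N; rewrite expr0 divr1; apply: le_trans; apply: nm_ge0.
have := us N.+1; rewrite big_ord_recl /= opprD addrA => /le_trans; apply.
rewrite ler_wpM2l // lef_pV2 ?posrE ?exprn_gt0 //.
by rewrite exprS ler_peMl ?exprn_ge0 // ler1n.
Qed.

(** The rate [K] leaves the conclusion because [K / 2 ^+ N] is arbitrarily small. The separate
    factor [M] is meant for powers of |w - z| when Taylor estimates are summed term by term. *)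
Lemma gsum_le u s K L (M : R) : gsum u s K ->
  (forall k, nm (u k) <= L / 2 ^+ k * M) -> nm s <= 2 * L * M.
Proof.
move=> us uM.
rewrite -subr_le0; apply: (@le_geom _ K) => N.
have {}us := us N.
have h : nm (\sum_(k < N) u k) <= 2 * L * M.
  have LM : 0 <= L * M.
    by have := uM 0%N; rewrite expr0 divr1; apply: le_trans; apply: nm_ge0.
  rewrite (le_trans (nm_sum _ _)) //.
  rewrite (le_trans (ler_sum _ (fun (k : 'I_N) _ => uM k))) //.
  rewrite (eq_bigr (fun k : 'I_N => L * M / 2 ^+ k)); last by move=> k _; ring.
  have := sum_geom LM (leq0n N).
  by rewrite big_mkord => /le_trans; apply; rewrite expr0 divr1 mulrA.
rewrite lerBlDr; apply: le_trans (lerD us h).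
by rewrite (le_trans _ (nmD _ _)) // subrK.
Qed.

(** Ratio test: [a n * 2 ^+ n] is nonincreasing from [N0] on, and [K] is the sum of its values up to
    [N0]. *)
Lemma geom_bound (a : nat -> R) (N0 : nat) : (forall n, 0 <= a n) ->
  (forall n, (N0 <= n)%N -> 2 * a n.+1 <= a n) ->
  exists K, forall n, a n <= K / 2 ^+ n.
Proof.
move=> a0 ar; exists (\sum_(k < N0.+1) a k * 2 ^+ k) => n.
rewrite ler_pdivlMr ?exprn_gt0 //.
have [nN|Nn] := leqP n N0.
  rewrite (bigD1 (Ordinal (nN : (n < N0.+1)%N))) //= lerDl sumr_ge0 // => k _.
  by rewrite mulr_ge0 ?exprn_ge0.
have {Nn}-> : n = (N0 + (n - N0))%N by rewrite subnKC // ltnW.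
elim: (n - N0)%N => [|m IH].
  by rewrite addn0 big_ord_recr /= lerDr sumr_ge0 // => k _; rewrite mulr_ge0 ?exprn_ge0.
rewrite addnS (le_trans _ IH) // exprS mulrCA mulrA ler_wpM2r ?exprn_ge0 //.
by rewrite ar // leq_addr.
Qed.

End GeometricSums.

(** * Functions with a quadratic Taylor estimate *)

Section BoundedC2.
Variable R : realType.
Implicit Types (D : R[i] -> Prop) (f g : R[i] -> R[i]) (M N : R).

(* A quantitative form of holomorphy, with [f'] the derivative: unlike mere
   differentiability it passes to products and to geometrically convergent sums
   with explicit constants, so that no Cauchy integral formula is needed. *)
Definition bnd D f f' M : Prop := forall z, D z ->
  [/\ nm (f z) <= M, nm (f' z) <= M & forall w, D w ->
    nm (f w - f z) <= M * nm (w - z) /\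
    nm (f w - f z - f' z * (w - z)) <= M * nm (w - z) ^+ 2].

Definition C2b D f := exists f' M, bnd D f f' M.

Lemma bnd_le D f f' M N : M <= N -> bnd D f f' M -> bnd D f f' N.
Proof.
move=> MN fM z Dz; have [h1 h2 h3] := fM z Dz.
split; [exact: le_trans MN|exact: le_trans MN|move=> w /h3 [h4 h5]].
split; [apply: le_trans h4 _|apply: le_trans h5 _].
  by rewrite ler_wpM2r ?nm_ge0.
by rewrite ler_wpM2r ?exprn_ge0 ?nm_ge0.
Qed.

Lemma eq_bnd D f g f' g' M : (forall z, D z -> f z = g z) ->
  (forall z, D z -> f' z = g' z) -> bnd D f f' M -> bnd D g g' M.
Proof.
move=> fg fg' fM z Dz; have [h1 h2 h3] := fM z Dz; rewrite -fg // -fg' //.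
by split=> // w Dw; rewrite -fg //; apply: h3.
Qed.

Lemma bnd_cst D c : bnd D (fun=> c) (fun=> 0) (nm c).
Proof.
move=> z Dz; rewrite nm0 nm_ge0; split=> // w Dw.
by rewrite subrr mul0r subrr nm0 !mulr_ge0 ?exprn_ge0 ?nm_ge0.
Qed.

Lemma bnd_id D r : (forall z, D z -> nm z <= r) ->
  bnd D id (fun=> 1) (r + 1).
Proof.
move=> Dr z Dz; have zr := Dr z Dz; have r0 : 0 <= r by apply: le_trans zr; apply: nm_ge0.
split; [by rewrite (le_trans zr) // lerDl|by rewrite nm1 lerDr|move=> w Dw].
rewrite mul1r subrr nm0 mulr_ge0 ?addr_ge0 ?exprn_ge0 ?nm_ge0 //.
by split=> //; rewrite ler_peMl ?nm_ge0 // lerDr.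
Qed.

Lemma bndD D f f' M g g' N : bnd D f f' M -> bnd D g g' N ->
  bnd D (fun z => f z + g z) (fun z => f' z + g' z) (M + N).
Proof.
move=> fM gN z Dz; have [f1 f2 f3] := fM z Dz; have [g1 g2 g3] := gN z Dz.
split; [exact: le_trans (nmD _ _) (lerD _ _)..|move=> w Dw].
have [f4 f5] := f3 w Dw; have [g4 g5] := g3 w Dw; rewrite !mulrDl; split.
  rewrite (_ : _ - _ = (f w - f z) + (g w - g z)); last by ring.
  exact: le_trans (nmD _ _) (lerD _ _).
rewrite (_ : _ - _ = (f w - f z - f' z * (w - z)) + (g w - g z - g' z * (w - z))); last by ring.
exact: le_trans (nmD _ _) (lerD _ _).
Qed.

(** The factor 3 counts the pieces of the second-order remainder of a product: f(w) times the
    remainder of g, the remainder of f times g(z), and the increment of f times the linear part of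
    g. *)
Lemma bndM D f f' M g g' N : bnd D f f' M -> bnd D g g' N ->
  bnd D (fun z => f z * g z) (fun z => f' z * g z + f z * g' z) (3 * (M * N)).
Proof.
move=> fM gN z Dz; have [f1 f2 f3] := fM z Dz; have [g1 g2 g3] := gN z Dz.
have M0 : 0 <= M := le_trans (nm_ge0 _) f1.
have N0 : 0 <= N := le_trans (nm_ge0 _) g1.
have MN0 : 0 <= M * N := mulr_ge0 M0 N0.
have mulle (a b : R[i]) x y : nm a <= x -> nm b <= y -> nm (a * b) <= x * y.
  by move=> ax bY; rewrite nmM ler_pM ?nm_ge0.
split.
- by rewrite (le_trans (mulle _ _ _ _ f1 g1)) //; lra.
- rewrite (le_trans (nmD _ _)) //.
  have := lerD (mulle _ _ _ _ f2 g1) (mulle _ _ _ _ f1 g2); lra.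
move=> w Dw; have [fw1 _ _] := fM w Dw.
have [f4 f5] := f3 w Dw; have [g4 g5] := g3 w Dw.
have h0 := nm_ge0 (w - z); have MNh := mulr_ge0 MN0 h0; split.
  rewrite (_ : _ - _ = f w * (g w - g z) + (f w - f z) * g z); last by ring.
  rewrite (le_trans (nmD _ _)) //.
  have := lerD (mulle _ _ _ _ fw1 g4) (mulle _ _ _ _ f4 g1); lra.
rewrite (_ : _ - _ = f w * (g w - g z - g' z * (w - z)) +
  (f w - f z - f' z * (w - z)) * g z + (f w - f z) * (g' z * (w - z))); last by ring.
rewrite (le_trans (nmD _ _)) //.
have g2h : nm (g' z * (w - z)) <= N * nm (w - z) by rewrite nmM ler_wpM2r.
have := lerD (lerD (mulle _ _ _ _ fw1 g5) (mulle _ _ _ _ f5 g1)) (mulle _ _ _ _ f4 g2h).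
have := nmD (f w * (g w - g z - g' z * (w - z))) ((f w - f z - f' z * (w - z)) * g z).
lra.
Qed.

Lemma bnd_inv D (delta : R) : 0 < delta -> (forall z, D z -> delta <= nm z) ->
  bnd D (fun z => z^-1) (fun z => - (z^-1 * z^-1))
    (delta^-1 + delta^-1 ^+ 2 + delta^-1 ^+ 3).
Proof.
move=> d0 Dd; set e := delta^-1; have e0 : 0 < e by rewrite invr_gt0.
have inve z : D z -> nm z^-1 <= e.
  by move=> /Dd dz; rewrite nmV lef_pV2 ?posrE // (lt_le_trans d0).
have nz z : D z -> z != 0 by move=> /Dd dz; rewrite -nm_gt0 (lt_le_trans d0).
have e2 : 0 <= e ^+ 2 by rewrite exprn_ge0 // ltW.
have e3 : 0 <= e ^+ 3 by rewrite exprn_ge0 // ltW.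
have mulle (a b : R[i]) x y : nm a <= x -> nm b <= y -> nm (a * b) <= x * y.
  by move=> ax bY; rewrite nmM ler_pM ?nm_ge0.
move=> z Dz; have zV := inve z Dz; have z0 := nz z Dz.
have zz : nm (z^-1 * z^-1) <= e ^+ 2 by rewrite expr2 mulle.
split; [by lra|by rewrite nmN; lra|move=> w Dw].
have wV := inve w Dw; have w0 := nz w Dw.
have h0 := nm_ge0 (w - z); split.
  rewrite (_ : _ - _ = (w^-1 * z^-1) * (z - w)); last by field; rewrite z0 w0.
  rewrite nmM (nmBC z) ler_wpM2r //.
  by have := mulle _ _ _ _ wV zV; rewrite -expr2; lra.
rewrite (_ : _ - _ = ((w^-1 * z^-1) * z^-1) * ((w - z) ^+ 2)); last by field; rewrite z0 w0.
rewrite nmM nmX ler_wpM2r ?exprn_ge0 //.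
have := mulle _ _ _ _ (mulle _ _ _ _ wV zV) zV; lra.
Qed.

Lemma bnd_shift D D' f f' M (c : R[i]) : (forall z, D' z -> D (z + c)) ->
  bnd D f f' M -> bnd D' (fun z => f (z + c)) (fun z => f' (z + c)) M.
Proof.
move=> DD fM z /DD Dz; have [h1 h2 h3] := fM _ Dz; split=> // w /DD /h3.
by rewrite (_ : w + c - (z + c) = w - z) //; ring.
Qed.

Lemma bnd_opp D D' f f' M (c : R[i]) : (forall z, D' z -> D (c - z)) ->
  bnd D f f' M -> bnd D' (fun z => f (c - z)) (fun z => - f' (c - z)) M.
Proof.
move=> DD fM z /DD Dz; have [h1 h2 h3] := fM _ Dz; split=> //; first by rewrite nmN.
move=> w /DD /h3.
rewrite (_ : c - w - (c - z) = - (w - z)); last by ring.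
by rewrite nmN mulrN mulNr.
Qed.

Lemma bndX D f f' M n : bnd D f f' M ->
  bnd D (fun z => f z ^+ n) (fun z => n%:R * f z ^+ n.-1 * f' z) ((3 * M) ^+ n).
Proof.
move=> fM; elim: n => [|n IH].
  rewrite expr0 -(nm1 R); apply: eq_bnd (@bnd_cst D 1) => z _.
    by rewrite expr0.
  by rewrite !mul0r.
rewrite exprS -mulrA; apply: eq_bnd (bndM fM IH) => z _; first by rewrite exprS.
by case: (n) => [|k]; rewrite ?expr0 ?exprS /= -?natr1; ring.
Qed.

(** This plays the part of the Weierstrass convergence theorem. Every estimate in [bnd] bounds an
    expression linear in the function and its derivative, so it survives summation, and the sum of
    the derivatives is the derivative of the sum. *)
Lemma bnd_csum D (f f' : nat -> R[i] -> R[i]) (K : R) :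
  (forall n, bnd D (f n) (f' n) (K / 2 ^+ n)) ->
  bnd D (fun z => csum (fun n => f n z)) (fun z => csum (fun n => f' n z)) (2 * K).
Proof.
move=> fK z Dz.
have sum1 w : D w -> gsum (fun n => f n w) (csum (fun n => f n w)) (4 * K).
  by move=> Dw; apply: csum_gsum => n; have [] := fK n w Dw.
have sum2 : gsum (fun n => f' n z) (csum (fun n => f' n z)) (4 * K).
  by apply: csum_gsum => n; have [] := fK n z Dz.
split.
- rewrite -[leRHS]mulr1; apply: gsum_le (sum1 z Dz) _ => n.
  by rewrite mulr1; have [] := fK n z Dz.
- rewrite -[leRHS]mulr1; apply: gsum_le sum2 _ => n.
  by rewrite mulr1; have [] := fK n z Dz.
move=> w Dw.
have sumd := gsumD (sum1 w Dw) (gsumZ (-1) (sum1 z Dz)).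
rewrite !mulN1r in sumd; split.
  apply: gsum_le sumd _ => n /=; rewrite mulN1r.
  by have [_ _ /(_ w Dw) []] := fK n z Dz.
have := gsumD sumd (gsumZ (- (w - z)) sum2); rewrite mulNr [(w - z) * _]mulrC.
move=> /gsum_le; apply=> n /=; rewrite mulN1r mulNr [(w - z) * _]mulrC.
by have [_ _ /(_ w Dw) []] := fK n z Dz.
Qed.

(* Halving the segment [N] times divides the quadratic error by [2 ^ N]. *)
Lemma bnd_const D f M : (forall z w, D z -> D w -> D ((z + w) / 2)) ->
  bnd D f (fun=> 0) M -> forall z w, D z -> D w -> f z = f w.
Proof.
move=> mid fM z w Dz Dw; apply/esym/eqP; rewrite -subr_eq0 -nm_eq0 eq_le nm_ge0 andbT.
apply: (@le_geom _ _ (M * nm (w - z) ^+ 2)) => N.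
elim: N z w Dz Dw => [|N IH] z w Dz Dw.
  by rewrite expr0 divr1; have [_ _ /(_ w Dw) []] := fM z Dz; rewrite mul0r subr0.
have Dm := mid _ _ Dz Dw; set m := (z + w) / 2 in Dm.
have h1 := IH _ _ Dz Dm; have h2 := IH _ _ Dm Dw.
have two0 : (2 : R[i]) != 0 by rewrite pnatr_eq0.
have half (x : R[i]) : nm (x / 2) = nm x / 2 by rewrite nmM nmV nm_nat.
have e1 : m - z = (w - z) / 2 by rewrite /m; field.
have e2 : w - m = (w - z) / 2 by rewrite /m; field.
rewrite e1 half in h1; rewrite e2 half in h2.
rewrite (_ : f w - f z = (f w - f m) + (f m - f z)); last by ring.
rewrite (le_trans (nmD _ _)) // (le_trans (lerD h2 h1)) //.
rewrite le_eqVlt; apply/orP; left; apply/eqP; rewrite [2 ^+ N.+1]exprS.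
have : (2 : R) ^+ N != 0 by rewrite expf_neq0 ?pnatr_eq0.
by move=> h; field.
Qed.

Lemma C2b_cst D c : C2b D (fun=> c).
Proof. by exists (fun=> 0), (nm c); apply: bnd_cst. Qed.

Lemma C2bD D f g : C2b D f -> C2b D g -> C2b D (fun z => f z + g z).
Proof. by move=> [f' [M fM]] [g' [N gN]]; eexists; eexists; apply: bndD fM gN. Qed.

Lemma C2bM D f g : C2b D f -> C2b D g -> C2b D (fun z => f z * g z).
Proof. by move=> [f' [M fM]] [g' [N gN]]; eexists; eexists; apply: bndM fM gN. Qed.

Lemma eq_C2b D f g : (forall z, D z -> f z = g z) -> C2b D f -> C2b D g.
Proof. by move=> fg [f' [M fM]]; exists f', M; apply: eq_bnd fM => // z Dz. Qed.

Lemma C2b_prod D (I : Type) (r : seq I) (F : I -> R[i] -> R[i]) :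
  (forall i, C2b D (F i)) -> C2b D (fun z => \prod_(i <- r) F i z).
Proof.
move=> h; elim: r => [|i r IH].
  by apply: eq_C2b (C2b_cst D 1) => z _; rewrite big_nil.
by apply: eq_C2b (C2bM (h i) IH) => z _; rewrite big_cons.
Qed.

End BoundedC2.

(** * The complex exponential *)

Section ComplexExponential.
Variable R : realType.
Implicit Types (D : R[i] -> Prop) (f g : R[i] -> R[i]) (x y z : R[i]).

Lemma fact_geom (K : R) : 0 <= K -> exists C, forall n, K ^+ n / n`!%:R <= C / 2 ^+ n.
Proof.
move=> K0; apply: (@geom_bound _ _ (Num.truncn (2 * K)).+1) => [n|n hn].
  by rewrite divr_ge0 ?exprn_ge0.
have f0 : (0 : R) < n`!%:R by rewrite ltr0n fact_gt0.
rewrite factS natrM exprS.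
have -> : 2 * (K * K ^+ n / (n.+1%:R * n`!%:R)) = 2 * K / n.+1%:R * (K ^+ n / n`!%:R).
  have : (n.+1%:R : R) != 0 by rewrite pnatr_eq0.
  by move: (n.+1%:R) => a a0; field; rewrite a0 lt0r_neq0.
rewrite ler_piMl ?divr_ge0 ?exprn_ge0 // ler_pdivrMr ?ltr0n // mul1r.
have : 2 * K < (Num.truncn (2 * K)).+1%:R by rewrite truncnS_gt.
move=> /ltW/le_trans; apply; rewrite ler_nat; exact: leq_trans hn _.
Qed.

Definition eseries (a : nat -> R[i]) z := csum (fun n => a n * z ^+ n).

Section EntireSeries.
Variable a : nat -> R[i].
Hypothesis ha : forall n, nm (a n) <= (n`!%:R)^-1.

Lemma bnd_eseries D f f' M : 0 <= M -> bnd D f f' M ->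
  exists N, bnd D (fun z => eseries a (f z))
    (fun z => csum (fun n => a n * (n%:R * f z ^+ n.-1 * f' z))) N.
Proof.
move=> M0 fM; have [|K hK] := @fact_geom (3 * (3 * M)); first by rewrite !mulr_ge0.
exists (2 * (3 * K)); apply: (@bnd_csum _ _ (fun n z => a n * f z ^+ n)) => n.
have := bndM (@bnd_cst _ D (a n)) (bndX n fM).
move=> h; apply: bnd_le (eq_bnd _ _ h) => // [|z _]; last by rewrite mul0r add0r.
rewrite -mulrA ler_wpM2l // (le_trans _ (hK n)) // mulrC ler_pM ?nm_ge0 ?exprn_ge0 ?mulr_ge0 //.
by rewrite lerXn2r ?nnegrE ?mulr_ge0 // ler_peMl ?mulr_ge0 // ler1n.
Qed.

Lemma C2b_eseries D f : C2b D f -> C2b D (fun z => eseries a (f z)).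
Proof.
move=> [f' [M fM]].
(* [M] is known to be nonnegative only if [D] is inhabited. *)
have M0 : 0 <= Num.max M 0 by rewrite le_max lexx orbT.
have [|N hN] := bnd_eseries M0 (_ : bnd D f f' (Num.max M 0)).
  by apply: bnd_le fM; rewrite le_max lexx.
by eexists; eexists; exact: hN.
Qed.

Lemma eseries_gsum z : exists K, gsum (fun n => a n * z ^+ n) (eseries a z) K.
Proof.
have [|K hK] := @fact_geom (nm z); first exact: nm_ge0.
exists (4 * K); apply: csum_gsum => n; rewrite nmM nmX (le_trans _ (hK n)) //.
by rewrite mulrC ler_wpM2l ?exprn_ge0 ?nm_ge0.
Qed.

Lemma eseries0 : eseries a 0 = a 0%N.
Proof.
have [K hK] := eseries_gsum 0; apply: gsum_uniq hK _ => //.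
instantiate (1 := nm (a 0%N)).
case=> [|N]; first by rewrite big_ord0 subr0 expr0 divr1.
rewrite big_ord_recl big1 ?addr0 => [|i _]; last by rewrite expr0n mulr0.
by rewrite expr0 mulr1 subrr nm0 divr_ge0 ?nm_ge0 ?exprn_ge0.
Qed.

End EntireSeries.

Definition expc := eseries (fun n => (n`!%:R)^-1).
(* [(exp z - 1) / z] with its singularity at 0 removed. *)
Definition expc1 := eseries (fun n => (n.+1`!%:R)^-1).

Lemma expc_coeff n : nm ((n`!%:R)^-1 : R[i]) <= (n`!%:R)^-1.
Proof. by rewrite nmV nm_nat. Qed.

Lemma expc1_coeff n : nm ((n.+1`!%:R)^-1 : R[i]) <= (n`!%:R)^-1.
Proof.
rewrite nmV nm_nat lef_pV2 ?posrE ?ltr0n ?fact_gt0 // ler_nat.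
by rewrite factS leq_pmull.
Qed.

Lemma C2b_expc D f : C2b D f -> C2b D (fun z => expc (f z)).
Proof. exact: C2b_eseries expc_coeff _ _. Qed.

Lemma C2b_expc1 D f : C2b D f -> C2b D (fun z => expc1 (f z)).
Proof. exact: C2b_eseries expc1_coeff _ _. Qed.

Lemma expc0 : expc 0 = 1.
Proof. by rewrite /expc (eseries0 expc_coeff) fact0 invr1. Qed.

Lemma expc1_0 : expc1 0 = 1.
Proof. by rewrite /expc1 (eseries0 expc1_coeff) invr1. Qed.

Lemma expc1E z : z * expc1 z = expc z - 1.
Proof.
have [K hK] := eseries_gsum expc_coeff z.
have [L hL] := eseries_gsum expc1_coeff z.
have h1 := gsumS hK; have h2 := gsumZ z hL.
rewrite /= fact0 invr1 mul1r expr0 in h1.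
apply: gsum_uniq h2 _; move: h1; congr gsum; apply: funext => n.
by rewrite exprS mulrCA.
Qed.

(** [expc] is its own derivative: the series of derivatives, whose terms are [u n] below, has a zero
    term of index 0, and its tail is the exponential series again. *)
Lemma bnd_expc (r : R) : 0 <= r ->
  exists M, bnd (fun z => nm z <= r) expc expc M.
Proof.
move=> r0; have r1 : 0 <= r + 1 by rewrite addr_ge0.
have [|M hM] := bnd_eseries expc_coeff r1 (@bnd_id _ (fun z => nm z <= r) r _) => //.
exists M; apply: eq_bnd hM => // z _; rewrite /expc /eseries.
have [K hK] := eseries_gsum expc_coeff z.
pose u n := (n`!%:R)^-1 * (n%:R * z ^+ n.-1 * 1) : R[i].
have us : (fun k => u k.+1) = (fun n => (n`!%:R)^-1 * z ^+ n).
  apply: funext => n; rewrite /u factS natrM /= mulr1 invfM.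
  have : (n.+1%:R : R[i]) != 0 by rewrite pnatr_eq0.
  have : (n`!%:R : R[i]) != 0 by rewrite pnatr_eq0 -lt0n fact_gt0.
  by move: (n.+1%:R) (n`!%:R) => a b b0 a0; field; rewrite a0 b0.
have [C' hC'] : exists C', forall n, nm (u n) <= C' / 2 ^+ n.
  have [|C' hC'] := @fact_geom (nm z); first exact: nm_ge0.
  exists (2 * C') => -[|n].
    rewrite /u mul0r mul0r mulr0 nm0 expr0 divr1.
    by have := hC' 0%N; rewrite !expr0 fact0 !divr1; lra.
  have -> : u n.+1 = (n`!%:R)^-1 * z ^+ n by have := congr1 (@^~ n) us.
  rewrite nmM nmX exprS -mulf_div divff ?pnatr_eq0 // mul1r (le_trans _ (hC' n)) //.
  by rewrite mulrC ler_wpM2l ?exprn_ge0 ?nm_ge0 // expc_coeff.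
have h := csum_gsum hC'; have := gsumS h; rewrite us.
rewrite {2}/u mul0r mul0r mulr0 subr0 => h3.
exact: gsum_uniq h3 hK.
Qed.

(* [exp z * exp (c - z)] has zero derivative. *)
Lemma expcD x y : expc (x + y) = expc x * expc y.
Proof.
pose c := x + y; pose r := nm x + nm c.
have r0 : 0 <= r by rewrite addr_ge0 ?nm_ge0.
have xr : nm x <= r by rewrite lerDl nm_ge0.
(* This radius leaves room for [c - z] when [z] runs over the disc of radius [r]. *)
have [M hM] := @bnd_expc (nm c + r) (addr_ge0 (nm_ge0 _) r0).
pose D z := nm z <= r.
have h1 : bnd D expc expc M.
  move=> z Dz; have Dz' : nm z <= nm c + r by rewrite (le_trans Dz) // lerDr nm_ge0.
  have [? ? h] := hM z Dz'; split=> // w Dw; apply: h.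
  by rewrite (le_trans Dw) // lerDr nm_ge0.
have h2 : bnd D (fun z => expc (c - z)) (fun z => - expc (c - z)) M.
  apply: bnd_opp hM => z Dz; by rewrite (le_trans (nmB _ _)) // lerD2l.
have h3 := bndM h1 h2.
have : bnd D (fun z => expc z * expc (c - z)) (fun=> 0) (3 * (M * M)).
  by apply: eq_bnd h3 => // z _; rewrite mulrN subrr.
move=> /bnd_const h; have := h _ 0 x; rewrite expc0 mul1r subr0 => ->.
- by rewrite /c addrC addKr.
- move=> z w Dz Dw; rewrite /D nmM nmV nm_nat ler_pdivrMr //.
  by rewrite (le_trans (nmD _ _)) //; have := lerD Dz Dw; rewrite /D; lra.
- by rewrite /D nm0.
- by [].
Qed.

Lemma expcN x : expc (- x) * expc x = 1.
Proof. by rewrite -expcD addNr expc0. Qed.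

Lemma expc_neq0 x : expc x != 0.
Proof.
by apply/eqP => h; have := expcN x; rewrite h mulr0 => /esym/eqP; rewrite oner_eq0.
Qed.

Lemma expcMn x n : expc (n%:R * x) = expc x ^+ n.
Proof.
elim: n => [|n IH]; first by rewrite mul0r expc0 expr0.
by rewrite -natr1 mulrDl mul1r expcD IH exprSr.
Qed.

Lemma expc_real (t : R) : expc (t%:C)%C = ((expR t)%:C)%C.
Proof.
have e n : ((n`!%:R)^-1 * (t%:C)%C ^+ n : R[i]) = ((exp_coeff t n)%:C)%C.
  by rewrite /exp_coeff /= rmorphM rmorphXn fmorphV rmorph_nat mulrC.
rewrite /expc /eseries /csum; under [fun n => complex.Re _]funext do rewrite e.
under [fun n => complex.Im _]funext do rewrite e.
rewrite /= /expR; congr (_ +i* _)%C.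
by rewrite /series /= (_ : (fun n => _) = fun=> 0) ?lim_cst //; apply: funext => n; rewrite big1.
Qed.

Lemma expc_imag (t : R) : expc (0 +i* t)%C = (cos t +i* sin t)%C.
Proof.
have e n : ((n`!%:R)^-1 * (0 +i* t)%C ^+ n : R[i]) =
    (cos_coeff t n +i* sin_coeff t n)%C.
  have -> : (n`!%:R)^-1 = ((n`!%:R^-1)%:C)%C :> R[i] by rewrite fmorphV rmorph_nat.
  (* The truncated predecessor in [n.-1./2] is harmless at [n = 0], where the factor [odd n]
     vanishes. *)
  have -> : (0 +i* t)%C ^+ n = ((~~ odd n)%:R * (-1) ^+ n./2 * t ^+ n
     +i* ((odd n)%:R * (-1) ^+ n.-1./2 * t ^+ n))%C :> R[i].
    elim: n => [|n IH]; first by rewrite !expr0 /= !mul1r !mul0r.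
    rewrite exprS IH /=; case: n {IH} => [|n] /=; simpc; rewrite ?negbK !exprS.
      by rewrite !expr0; congr (_ +i* _)%C; ring.
    by case: (odd n); congr (_ +i* _)%C => /=; ring.
  by rewrite /cos_coeff /sin_coeff /=; simpc; congr (_ +i* _)%C; rewrite mulrC.
rewrite /expc /eseries /csum; under [fun n => complex.Re _]funext do rewrite e.
under [fun n => complex.Im _]funext do rewrite e.
by congr (_ +i* _)%C; rewrite unlock.
Qed.

Definition twopii : R[i] := (0 +i* (2 * pi))%C.

Lemma expc_twopii : expc twopii = 1.
Proof.
have -> : twopii = 2%:R * (0 +i* pi)%C.
  by rewrite mulr_natl mulr2n; simpc; rewrite /twopii -mulr2n mulr_natl.
by rewrite expcMn expc_imag cospi sinpi; rewrite -[(_ +i* _)%C]/((-1)%:C)%C -rmorphXn sqrrN expr1n.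
Qed.

Lemma twopii_neq0 : twopii != 0.
Proof. by rewrite eq_complex /= negb_and eqxx /= mulf_neq0 ?pnatr_eq0 ?lt0r_neq0 ?pi_gt0. Qed.

End ComplexExponential.

(** * Algebra of the bilateral Poincare series *)


(* [(z - a)^-1], with its pole removed when it sits at [z0]. *)
Definition pole_inv (F : fieldType) (z0 a z : F) : F := if z0 == a then 1 else (z - a)^-1.

Lemma pole_invE (F : fieldType) (z0 a z : F) : z != z0 ->
  (z - a)^-1 * (z - z0) ^+ (z0 == a) = pole_inv z0 a z.
Proof.
rewrite /pole_inv; have [-> za|_ _] := eqVneq z0 a; last by rewrite mulr1.
by rewrite expr1 mulVf // subr_eq0.
Qed.

Section Construction.
(** [E] stands for exp(2 pi i z) and [ex] for exp; only their functional equations matter here. The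
    system is A = P / q, [H] is the half-plane, and [rq], [rb] list the roots of q and of det P with
    multiplicity, which include the poles of A and of its inverse. *)
Variables (F : numFieldType) (E ex : F -> F) (d : nat) (P : 'M[{poly F}]_d).
Variables (q : {poly F}) (lq lb : F) (rq rb : seq F) (H : F -> Prop) (c : F).
Variable v : 'cV[F]_d.
Implicit Types z w a : F.
Hypothesis ED : forall x y, E (x + y) = E x * E y.
Hypothesis E1 : E 1 = 1.
Hypothesis exD : forall x y, ex (x + y) = ex x * ex y.
Hypothesis ex0 : ex 0 = 1.
Hypothesis lq0 : lq != 0.
Hypothesis lb0 : lb != 0.
Hypothesis qE : q = lq *: \prod_(r <- rq) ('X - r%:P).
Hypothesis detE : \det P = lb *: \prod_(p <- rb) ('X - p%:P).
Hypothesis rqH : forall r, r \in rq -> ~ H r.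
Hypothesis rbH : forall p, p \in rb -> ~ H p.
Hypothesis H_sub : forall z n, H z -> H (z - n%:R).
Hypothesis cH : H c.

Definition eval_mx z (M : 'M[{poly F}]_d) : 'M[F]_d := map_mx (horner_eval z) M.
Definition step_mx z := (q.[z])^-1 *: eval_mx z P.
(** By Cramer's rule A^-1 = q adj(P) / det P. The polynomial part is kept apart from the linear
    factors at the roots of det P, since only the latter have to be regularized. *)
Definition inv_step_num z := (lb^-1 * q.[z]) *: eval_mx z (\adj P).
Definition inv_step_mx z := (\prod_(p <- rb) (z - p)^-1) *: inv_step_num z.

Let E_nat n : E n%:R = 1.
Proof.
elim: n => [|n IH]; last by rewrite -natr1 ED IH E1 mulr1.
by have := ED 0 1; rewrite add0r E1 mulr1.
Qed.

Let EN x : E x = 1 -> E (- x) = 1.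
Proof. by move=> Ex; have := ED x (- x); rewrite subrr (E_nat 0) Ex mul1r. Qed.

Let exMn x n : ex (n%:R * x) = ex x ^+ n.
Proof.
elim: n => [|n IH]; first by rewrite mul0r ex0 expr0.
by rewrite -natr1 mulrDl mul1r exD IH exprSr.
Qed.

Lemma denominatorE z : q.[z] = lq * \prod_(r <- rq) (z - r).
Proof.
rewrite qE hornerZ horner_prod; congr (_ * _); apply: eq_bigr => r _.
by rewrite hornerXsubC.
Qed.

Lemma prod_root_neq0 s z : (forall r, r \in s -> ~ H r) -> H z -> \prod_(r <- s) (z - r) != 0.
Proof.
move=> hs hz; rewrite prodf_seq_neq0; apply/allP => r rs /=.
by rewrite subr_eq0; apply/eqP => zr; apply: (hs r) => //; rewrite -zr.
Qed.

Lemma denominator_neq0 z : H z -> q.[z] != 0.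
Proof. by move=> hz; rewrite denominatorE mulf_neq0 // prod_root_neq0 //; apply: rqH. Qed.

Lemma step_mxK z : H z -> step_mx z *m inv_step_mx z = 1%:M.
Proof.
move=> hz; rewrite /step_mx /inv_step_mx /inv_step_num -!scalemxAl -!scalemxAr -map_mxM mul_mx_adj.
rewrite map_scalar_mx !scalerA /= /horner_eval detE hornerZ horner_prod.
have -> : \prod_(p <- rb) ('X - p%:P).[z] = \prod_(p <- rb) (z - p).
  by apply: eq_bigr => p _; rewrite hornerXsubC.
rewrite scale_scalar_mx prodfV; congr (_%:M).
have h1 := denominator_neq0 hz; have h2 := prod_root_neq0 rbH hz.
by field; rewrite h1 h2 lb0.
Qed.

(* [left_prod n z = A(z-1) ... A(z-n)] and [right_prod n z = A(z)^-1 ... A(z+n-1)^-1]. *)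
Fixpoint left_prod n z : 'M[F]_d :=
  if n is k.+1 then left_prod k z *m step_mx (z - k.+1%:R) else 1%:M.
Fixpoint right_prod n z : 'M[F]_d :=
  if n is k.+1 then right_prod k z *m inv_step_mx (z + k%:R) else 1%:M.

Lemma left_prod_shift n z : left_prod n.+1 (z + 1) = step_mx z *m left_prod n z.
Proof.
elim: n => [|n IH]; first by rewrite /= mul1mx mulmx1 addrK.
rewrite [LHS]/= -/(left_prod n.+1 (z + 1)) IH -mulmxA /=; congr (_ *m (_ *m step_mx _)).
by rewrite -[n.+2%:R]natr1; ring.
Qed.

Lemma right_prod_shift n z : right_prod n.+1 z = inv_step_mx z *m right_prod n (z + 1).
Proof.
elim: n => [|n IH]; first by rewrite /= mul1mx mulmx1 addr0.
rewrite [LHS]/= -/(right_prod n.+1 z) IH -mulmxA /=; congr (_ *m (_ *m inv_step_mx _)).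
by rewrite -[n.+1%:R]natr1; ring.
Qed.

(* The exponent is chosen so that the pole of [seed] at [c] has exactly the
   order of the zero of [periodic_factor] there. *)
Definition pole_exponent : nat := (\sum_(p <- rb) (E (p - c) == 1)%R + 1)%N.
Definition seed w := ex (- (w * w)) * (w - c)^-1 ^+ pole_exponent.
Definition left_term n z : 'cV[F]_d := seed (z - n%:R) *: (left_prod n z *m v).
Definition right_term n z : 'cV[F]_d := seed (z + n%:R) *: (right_prod n z *m v).
Lemma left_termS n z : left_term n.+1 (z + 1) = step_mx z *m left_term n z.
Proof.
have e : z + 1 - n.+1%:R = z - n%:R by rewrite -natr1; ring.
by rewrite /left_term e left_prod_shift -mulmxA -scalemxAr.
Qed.

Lemma right_termS n z : H z -> step_mx z *m right_term n.+1 z = right_term n (z + 1).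
Proof.
move=> hz; have e : z + n.+1%:R = z + 1 + n%:R by rewrite -natr1; ring.
by rewrite /right_term e right_prod_shift -scalemxAr 2!mulmxA step_mxK // mul1mx.
Qed.

Definition periodic_factor z := \prod_(p <- rb) (E (z - p) - 1) * (E (z - c) - 1).

Lemma periodic_factor_shift z : periodic_factor (z + 1) = periodic_factor z.
Proof.
have h a : E (z + 1 - a) = E (z - a) by rewrite addrAC (ED (z - a)) E1 mulr1.
by rewrite /periodic_factor h; congr (_ * _); apply: eq_bigr => p _; rewrite h.
Qed.

Lemma periodic_factor_step (M : 'M[F]_d) (S : F -> 'cV[F]_d) z :
  S (z + 1) = M *m S z ->
  periodic_factor (z + 1) *: S (z + 1) = M *m (periodic_factor z *: S z).
Proof. by move=> ->; rewrite periodic_factor_shift scalemxAr. Qed.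

Section Local.
Variable z0 : F.

(** The order of the zero of [periodic_factor] at [z0]: each factor [E (z - a) - 1] contributes a
    simple zero when [a] is congruent to [z0] modulo the integers. *)
Definition cleared_order : nat := (\sum_(p <- rb) (E (p - z0) == 1)%R + (E (c - z0) == 1)%R)%N.
(** An upper bound for the order of the pole of [right_prod n] at [z0]; the numerators may cancel
    part of it. *)
Definition right_pole_order n : nat := (\sum_(l < n) \sum_(p <- rb) (z0 == p - l%:R)%R)%N.

Lemma periodic_factorE (r : F -> F) z :
  (forall a, E (z - a) - 1 = (z - z0) ^+ (E (a - z0) == 1) * r a) ->
  periodic_factor z = (z - z0) ^+ cleared_order * (\prod_(p <- rb) r p * r c).
Proof.
move=> hr; have h (s : seq F) : \prod_(p <- s) (E (z - p) - 1) =
    (z - z0) ^+ (\sum_(p <- s) (E (p - z0) == 1)%R) * \prod_(p <- s) r p.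
  elim: s => [|p s IH]; first by rewrite !big_nil mulr1.
  by rewrite !big_cons IH hr exprD; ring.
by rewrite /periodic_factor h hr /cleared_order exprD; ring.
Qed.

Lemma cleared_order_exponent : E (c - z0) = 1 -> cleared_order = pole_exponent.
Proof.
move=> h; have e p : E (p - z0) = E (p - c).
  by rewrite -[RHS]mulr1 -h -ED addrA subrK.
rewrite /cleared_order /pole_exponent; under eq_bigr do rewrite e.
by rewrite h eqxx.
Qed.

Lemma period_plus n : z0 = c + n%:R -> E (c - z0) = 1.
Proof. by move=> ->; rewrite opprD addrA subrr add0r EN ?E_nat. Qed.

Lemma period_minus n : z0 = c - n%:R -> E (c - z0) = 1.
Proof. by move=> ->; rewrite opprB addrC subrK E_nat. Qed.

Lemma left_order_le n : (pole_exponent * (z0 == c + n%:R)%R <= cleared_order)%N.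
Proof.
by case: eqP => [/period_plus/cleared_order_exponent ->|_]; rewrite ?muln1 ?muln0.
Qed.

(** In characteristic 0 a root [p] meets [z0 = p - l] for at most one [l], and then it is congruent
    to [z0]. Hence the bound does not grow with [n]. *)
Lemma right_pole_order_le n : (right_pole_order n <= \sum_(p <- rb) (E (p - z0) == 1)%R)%N.
Proof.
rewrite /right_pole_order exchange_big /=; apply: leq_sum => p _.
have [h|h] := eqVneq (E (p - z0)) 1; last first.
  rewrite big1 // => l _; case: eqP => // zE; case/eqP: h.
  by rewrite zE opprB addrC subrK E_nat.
have [/existsP [l /eqP hl]|/existsPn no] := boolP [exists l : 'I_n, z0 == p - l%:R].
  rewrite (bigD1 l) //= big1 ?addn0 ?leq_b1 // => k kl.
  case: eqP => // hk; case/eqP: kl; apply/val_inj/eqP.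
  by rewrite -(eqr_nat F); apply/eqP; apply: oppr_inj; apply: (addrI p); rewrite -hk -hl.
by rewrite big1 // => l _; rewrite (negbTE (no l)).
Qed.

(** The two sources of poles exclude each other. If [z0 = c - n], a root with [z0 = p - l] and
    [l < n] would be [p = c - (n - l)], which lies in [H] together with [c], while the roots in [rb]
    lie outside. *)
Lemma right_order_le n : (pole_exponent * (z0 == c - n%:R)%R + right_pole_order n <= cleared_order)%N.
Proof.
have [zE|_] := eqVneq z0 (c - n%:R); last first.
  by rewrite muln0 (leq_trans (right_pole_order_le n)) // leq_addr.
rewrite (cleared_order_exponent (period_minus zE)) muln1 /right_pole_order big1 ?addn0 // => l _.
rewrite big1_seq // => p /andP[_ prb]; case: eqP => // zE'.
case: (rbH prb).
have -> : p = c - (n - l)%:R.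
  by rewrite natrB ?(ltnW (ltn_ord l)) // opprB addrA addrAC -zE zE' subrK.
exact: H_sub.
Qed.

Definition gauss_coeff n : F := ex (- (n%:R * n%:R)).

(** The poles at [z0] are removed factor by factor, so that the product keeps a meaning at [z0]
    itself. *)
Fixpoint right_prod_reg n z : 'M[F]_d :=
  if n is k.+1 then
    right_prod_reg k z *m ((\prod_(p <- rb) pole_inv z0 (p - k%:R) z) *: inv_step_num (z + k%:R))
  else 1%:M.

Lemma pole_prod (s : seq F) (a : F -> F) z : z != z0 ->
  (z - z0) ^+ (\sum_(p <- s) (z0 == a p)) * \prod_(p <- s) (z - a p)^-1 =
  \prod_(p <- s) pole_inv z0 (a p) z.
Proof.
move=> zz; elim: s => [|p s IH]; first by rewrite !big_nil expr0 mul1r.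
by rewrite !big_cons -IH exprD -(pole_invE _ zz); ring.
Qed.

Lemma right_prod_regE n z : z != z0 -> (z - z0) ^+ right_pole_order n *: right_prod n z = right_prod_reg n z.
Proof.
move=> zz; elim: n => [|n IH]; first by rewrite /right_pole_order big_ord0 expr0 scale1r.
have eP : \prod_(p <- rb) (z + n%:R - p)^-1 = \prod_(p <- rb) (z - (p - n%:R))^-1.
  by apply: eq_bigr => p _; congr (_^-1); ring.
rewrite /= -IH -scalemxAl /inv_step_mx eP /inv_step_num -!scalemxAr !scalerA -pole_prod //.
by congr (_ *: _); rewrite /right_pole_order big_ord_recr exprD /=; ring.
Qed.

(* The [n]-th terms near [z0], multiplied by [(z - z0) ^+ cleared_order] to clear
   their poles at [z0] and divided by [gauss_coeff n]. *)
Definition left_reg n z i := ex (- (z * z)) * ex (2 * z) ^+ n *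
  pole_inv z0 (c + n%:R) z ^+ pole_exponent *
  (z - z0) ^+ (cleared_order - pole_exponent * (z0 == c + n%:R)%R)%N *
  (left_prod n z *m v) i 0.
Definition right_reg n z i := ex (- (z * z)) * ex (- (2 * z)) ^+ n *
  pole_inv z0 (c - n%:R) z ^+ pole_exponent *
  (z - z0) ^+ (cleared_order - (pole_exponent * (z0 == c - n%:R)%R + right_pole_order n)) *
  (right_prod_reg n z *m v) i 0.

Lemma pole_factor a z m : z != z0 -> (pole_exponent * (z0 == a)%R <= m)%N ->
  (z - z0) ^+ m * (z - a)^-1 ^+ pole_exponent =
  pole_inv z0 a z ^+ pole_exponent * (z - z0) ^+ (m - pole_exponent * (z0 == a)%R)%N.
Proof.
move=> zz le; rewrite -{1}(subnKC le) exprD -(pole_invE _ zz) exprMn -exprM.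
by rewrite [(_ * pole_exponent)%N]mulnC; ring.
Qed.

Lemma left_regE n z i : z != z0 ->
  (z - z0) ^+ cleared_order * left_term n z i 0 = gauss_coeff n * left_reg n z i.
Proof.
move=> zz; rewrite /left_term mxE /seed /left_reg.
(* Expanding the square isolates exp(- n ^ 2), which is free of z; what remains grows only
   geometrically in n. *)
have -> : ex (- ((z - n%:R) * (z - n%:R))) = gauss_coeff n * (ex (- (z * z)) * ex (2 * z) ^+ n).
  by rewrite /gauss_coeff -exMn -!exD; congr ex; ring.
have -> : z - n%:R - c = z - (c + n%:R) by ring.
have h := pole_factor zz (left_order_le n).
rewrite !mulrA -[_ * pole_inv _ _ _ ^+ _ * _]mulrA -h; ring.
Qed.

Lemma right_regE n z i : z != z0 ->
  (z - z0) ^+ cleared_order * right_term n z i 0 = gauss_coeff n * right_reg n z i.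
Proof.
move=> zz; have scE (a : F) (M : 'cV[F]_d) : (a *: M) i 0 = a * M i 0 by rewrite mxE.
rewrite /right_term scE /seed /right_reg -(right_prod_regE n zz) -scalemxAl scE.
have -> : ex (- ((z + n%:R) * (z + n%:R))) =
    gauss_coeff n * (ex (- (z * z)) * ex (- (2 * z)) ^+ n).
  by rewrite /gauss_coeff -exMn -!exD; congr ex; ring.
have -> : z + n%:R - c = z - (c - n%:R) by ring.
have le := right_order_le n.
have le' : (pole_exponent * (z0 == c - n%:R)%R <= cleared_order - right_pole_order n)%N.
  by rewrite leq_subRL ?(leq_trans _ le) ?leq_addl // addnC.
have h := pole_factor zz le'.
rewrite addnC subnDA.
have -> : (z - z0) ^+ cleared_order =
    (z - z0) ^+ (cleared_order - right_pole_order n) * (z - z0) ^+ right_pole_order n.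
  by rewrite -exprD subnK // (leq_trans _ le) ?leq_addl.
rewrite !mulrA -[_ * pole_inv _ _ _ ^+ _ * _]mulrA -h; ring.
Qed.

Section Center.
Hypothesis zc : z0 = c.

Let mE : cleared_order = (\sum_(p <- rb) (E (p - z0) == 1)%R + 1)%N.
Proof. by rewrite /cleared_order zc subrr (E_nat 0) eqxx. Qed.

Let mL : cleared_order = pole_exponent.
Proof. by apply: cleared_order_exponent; rewrite zc subrr (E_nat 0). Qed.

Let qc0 : gauss_coeff 0 = 1. Proof. by rewrite /gauss_coeff mulr0 oppr0 ex0. Qed.

Lemma left_reg_center0 i : gauss_coeff 0 * left_reg 0 z0 i = ex (- (z0 * z0)) * v i 0.
Proof.
rewrite qc0 mul1r /left_reg expr0 mulr1 addr0 mL /pole_inv zc eqxx muln1 subnn !expr0.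
by rewrite expr1n !mulr1 mul1mx.
Qed.

Lemma right_reg_center0 i : gauss_coeff 0 * right_reg 0 z0 i = ex (- (z0 * z0)) * v i 0.
Proof.
rewrite qc0 mul1r /right_reg expr0 mulr1 subr0 mL /pole_inv zc eqxx muln1 /right_pole_order big_ord0.
by rewrite addn0 subnn !expr0 expr1n !mulr1 mul1mx.
Qed.

Lemma left_reg_centerS n i : gauss_coeff n.+1 * left_reg n.+1 z0 i = 0.
Proof.
rewrite /left_reg.
have -> : (z0 == c + n.+1%:R) = false :> bool.
  by rewrite zc -subr_eq0 opprD addrA subrr add0r oppr_eq0 pnatr_eq0.
by rewrite muln0 subn0 subrr expr0n mE addn1 mulr0 mul0r mulr0.
Qed.

(** The products of inverses may well have poles at [c], but of total order at most
    [cleared_order - 1], thanks to the factor [E (z - c) - 1] of [periodic_factor]. A positive power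
    of (z - c) is therefore left over. *)
Lemma right_reg_centerS n i : gauss_coeff n.+1 * right_reg n.+1 z0 i = 0.
Proof.
rewrite /right_reg.
have -> : (z0 == c - n.+1%:R) = false :> bool.
  by rewrite zc -subr_eq0 opprB addrC subrK pnatr_eq0.
rewrite muln0 add0n subrr expr0n subn_eq0 leqNgt mE addn1 ltnS right_pole_order_le.
by rewrite mulr0 mul0r mulr0.
Qed.

End Center.

End Local.
End Construction.

(** * Sequences of functions of controlled growth *)

Section Neighborhoods.
Variable R : realType.
Implicit Types (z : R[i]) (P : R[i] -> Prop).

Lemma nbhsCP z P :
  (\forall w \near (z : R[i]^o), P w) <-> exists2 r : R, 0 < r & forall w, nm (w - z) < r -> P w.
Proof.
split.
  move=> /nbhs_normP [e /= e0 he]; have e0' := e0.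
  rewrite ltcE /= in e0'; case/andP: e0' => /eqP ime ree; exists (complex.Re e) => // w wr.
  apply: he => /=; rewrite /ball_ /= -normrN opprB normE ltcE /= wr andbT.
  by rewrite ime.
move=> [r r0 hr]; apply/nbhs_normP; exists (r%:C)%C; first by rewrite /= ltcR.
by move=> w /=; rewrite -normrN opprB normE ltcR; apply: hr.
Qed.

Lemma dnbhsCP z P :
  (\forall w \near (z : R[i]^o)^', P w) <->
  exists2 r : R, 0 < r & forall w, w != z -> nm (w - z) < r -> P w.
Proof.
rewrite /dnbhs /= /within /=; split.
  by move=> /nbhsCP [r r0 hr]; exists r => // w wz wr; apply: hr.
by move=> [r r0 hr]; apply/nbhsCP; exists r => // w wr wz; apply: hr.
Qed.

Lemma bnd_derivable (D : R[i] -> Prop) f f' M z (r : R) : 0 < r ->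
  (forall w : R[i], nm (w - z) < r -> D w) -> bnd D f f' M ->
  derivable (f : R[i]^o -> R[i]^o) (z : R[i]^o) 1.
Proof.
move=> r0 rD fM.
have Dz : D z by apply: rD; rewrite subrr nm0.
have [_ _ h] := fM z Dz.
apply/cvg_ex; exists (f' z); apply/cvgrPdist_le => eps eps0.
have := eps0; rewrite ltcE /= => /andP[/eqP ime ree].
have epsE : eps = ((complex.Re eps)%:C)%C by move: ime; case: (eps) => a b /= ->.
have M0 : 0 <= M by have [hM _ _] := fM z Dz; apply: le_trans hM; apply: nm_ge0.
apply/dnbhsCP; exists (Num.min r (complex.Re eps / (M + 1))).
  by rewrite lt_min r0 divr_gt0 // ltr_pwDr.
move=> k k0; rewrite subr0 lt_min => /andP[kr ke].
have [|_ h2] := h (k + z); first by apply: rD; rewrite addrK.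
rewrite normE epsE lecR.
rewrite addrK in h2.
have k0' : 0 < nm k by rewrite nm_gt0.
rewrite (_ : _ - _ = - (k^-1 * (f (k + z) - f z - f' z * k))); last first.
  rewrite -[k *: _]/(k * 1) mulr1 -[k^-1 *: _]/(k^-1 * _).
  by field.
rewrite nmN nmM nmV mulrC ler_pdivrMr // (le_trans h2) // expr2 mulrA ler_wpM2r ?nm_ge0 //.
rewrite ltr_pdivlMr ?ltr_pwDr // in ke.
have := nm_ge0 k; lra.
Qed.

Lemma C2b_derivable (D : R[i] -> Prop) f z (r : R) : 0 < r ->
  (forall w : R[i], nm (w - z) < r -> D w) -> C2b D f ->
  derivable (f : R[i]^o -> R[i]^o) (z : R[i]^o) 1.
Proof. by move=> r0 rD [f' [M fM]]; apply: (bnd_derivable r0 rD fM). Qed.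

Lemma C2b_holomorphic (r : R) f z : 0 < r ->
  C2b (fun w => nm (w - z) < r) f -> holomorphic_at f z.
Proof.
move=> r0 fC; apply/nbhsCP; exists r => // w wr.
apply: (@C2b_derivable _ _ _ (r - nm (w - z)) _ _ fC); first by rewrite subr_gt0.
move=> x xw; rewrite (_ : x - z = (x - w) + (w - z)); last by rewrite addrA subrK.
by rewrite (le_lt_trans (nmD _ _)) // -ltrBrDr.
Qed.

End Neighborhoods.

Section SequencesOfBoundedFunctions.
Variable R : realType.
Variable D : R[i] -> Prop.
Implicit Types W : nat -> R.

(* Bounds growing at most like a power of the weight [W n]. *)
Definition sbnd W f := exists m, forall n, exists f', bnd D (f n) f' (W n ^+ m).

(** The condition [3 <= W n] lets one further power of the weight absorb the factor 3 of the product
    rule. *)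
Lemma sbndM W f g : (forall n, 3 <= W n) ->
  sbnd W f -> sbnd W g -> sbnd W (fun n z => f n z * g n z).
Proof.
move=> W3 [m hf] [p hg]; exists (1 + (m + p))%N => n.
have [f' fM] := hf n; have [g' gM] := hg n.
eexists; apply: bnd_le (bndM fM gM); rewrite !exprD expr1.
by rewrite ler_wpM2r // mulr_ge0 ?exprn_ge0 // (le_trans _ (W3 n)).
Qed.

Lemma sbndD W f g : (forall n, 3 <= W n) ->
  sbnd W f -> sbnd W g -> sbnd W (fun n z => f n z + g n z).
Proof.
move=> W3 [m hf] [p hg]; exists (1 + (m + p))%N => n.
have [f' fM] := hf n; have [g' gM] := hg n.
have W1 k : 1 <= W n ^+ k by rewrite exprn_ege1 // (le_trans _ (W3 n)) // ler1n.
eexists; apply: bnd_le (bndD fM gM); rewrite !exprD expr1.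
have h1 : W n ^+ m <= W n ^+ m * W n ^+ p by rewrite ler_peMr // (le_trans _ (W1 m)).
have h2 : W n ^+ p <= W n ^+ m * W n ^+ p by rewrite ler_peMl // (le_trans _ (W1 p)).
have h3 : 2 * (W n ^+ m * W n ^+ p) <= W n * (W n ^+ m * W n ^+ p).
  by rewrite ler_wpM2r ?mulr_ge0 ?(le_trans ler01) // (le_trans _ (W3 n)) // ler_nat.
lra.
Qed.

Lemma sbnd_unif W f (M : R) : (forall n, 3 <= W n) ->
  (forall n, exists f', bnd D (f n) f' M) -> sbnd W f.
Proof.
move=> W3 fM; pose k := (Num.truncn M).+1; exists k => n.
have [f' h] := fM n; exists f'; apply: bnd_le h.
have Mk : M <= k%:R by rewrite ltW // truncnS_gt.
apply: (le_trans Mk); rewrite (@le_trans _ _ (3 ^+ k)) //.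
  by rewrite -natrX ler_nat ltnW // ltn_expl.
by rewrite lerXn2r ?nnegrE // (le_trans _ (W3 n)).
Qed.

Lemma sbnd_cst W (f : R[i] -> R[i]) : (forall n, 3 <= W n) ->
  C2b D f -> sbnd W (fun=> f).
Proof. by move=> W3 [f' [M fM]]; apply: (@sbnd_unif _ _ M) => // n; exists f'. Qed.

Lemma eq_sbnd W f g : (forall n z, D z -> f n z = g n z) -> sbnd W f -> sbnd W g.
Proof.
move=> fg [m h]; exists m => n; have [f' fM] := h n; exists f'.
by apply: eq_bnd fM => // z Dz; rewrite fg.
Qed.

Lemma sbnd_sum W (I : Type) (r : seq I) (F : I -> nat -> R[i] -> R[i]) :
  (forall n, 3 <= W n) -> (forall i, sbnd W (F i)) ->
  sbnd W (fun n z => \sum_(i <- r) F i n z).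
Proof.
move=> W3 h; elim: r => [|i r IH].
  by apply: eq_sbnd (sbnd_cst W3 (C2b_cst D 0)) => n z _; rewrite big_nil.
by apply: eq_sbnd (sbndD W3 (h i) IH) => n z _; rewrite big_cons.
Qed.

Lemma sbnd_prod W (I : eqType) (r : seq I) (F : I -> nat -> R[i] -> R[i]) :
  (forall n, 3 <= W n) -> (forall i, i \in r -> sbnd W (F i)) ->
  sbnd W (fun n z => \prod_(i <- r) F i n z).
Proof.
move=> W3; elim: r => [|i r IH] h.
  by apply: eq_sbnd (sbnd_cst W3 (C2b_cst D 1)) => n z _; rewrite big_nil.
have {}IH := IH (fun k kr => h k (mem_behead (s := i :: r) kr)).
by apply: eq_sbnd (sbndM W3 (h i (mem_head _ _)) IH) => n z _; rewrite big_cons.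
Qed.

Lemma sbndX W f k : (forall n, 3 <= W n) ->
  sbnd W f -> sbnd W (fun n z => f n z ^+ k).
Proof.
move=> W3 h; elim: k => [|k IH].
  by apply: eq_sbnd (sbnd_cst W3 (C2b_cst D 1)) => n z _; rewrite expr0.
by apply: eq_sbnd (sbndM W3 h IH) => n z _; rewrite exprS.
Qed.

(** The offset 3 gives [3 <= W n] already at [n = 0]. This weight measures a single factor of the
    products, and [fact_weight] the product of the first n factors. *)
Definition lin_weight n : R := (n + 3)%:R.
Definition fact_weight n : R := (n + 3)`!%:R.

Lemma lin_weight_ge3 n : 3 <= lin_weight n.
Proof. by rewrite ler_nat leq_addl. Qed.

Lemma fact_weight_ge3 n : 3 <= fact_weight n.
Proof. by rewrite ler_nat addn3 (leq_trans _ (fact_geq _)). Qed.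

Lemma sbnd_nat : sbnd lin_weight (fun n _ => n%:R).
Proof.
exists 1%N => n; exists (fun=> 0); apply: bnd_le (@bnd_cst _ D n%:R).
by rewrite nm_nat expr1 ler_nat leq_addr.
Qed.

(** With exponent m + 1 + d, passing from n to n + 1 gains the factor (n + 4) ^ (m + 1 + d): the m
    powers pay for the new matrix, one for the 3 of the product rule, and d for the d summands of
    each entry. *)
Lemma sbnd_partial_prod d (F : nat -> R[i] -> 'M[R[i]]_d)
    (G : nat -> R[i] -> 'M[R[i]]_d) :
  (forall i j, sbnd lin_weight (fun n z => F n z i j)) ->
  (forall z, G 0%N z = 1%:M) -> (forall n z, G n.+1 z = G n z *m F n z) ->
  forall i j, sbnd fact_weight (fun n z => G n z i j).
Proof.
move=> hF G0 GS.
have [m hm] : exists m, forall i j n, exists f', bnd D (fun z => F n z i j) f' (lin_weight n ^+ m).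
  have [m hm] := choice (fun ij : 'I_d * 'I_d => hF ij.1 ij.2).
  exists (\sum_ij m ij)%N => i j n; have [f' fM] := hm (i, j) n; exists f'.
  apply: bnd_le fM; rewrite ler_weXn2l //.
    by rewrite (le_trans _ (lin_weight_ge3 n)) // ler1n.
  by rewrite (bigD1 (i, j)) //= leq_addr.
suff h n i j : exists f', bnd D (fun z => G n z i j) f' (fact_weight n ^+ (m + 1 + d)).
  by move=> i j; exists (m + 1 + d)%N => n; apply: h.
elim: n i j => [|n IH] i j.
  exists (fun=> 0); apply: (@eq_bnd _ _ (fun=> (i == j)%:R) _ (fun=> 0)) => [z _|//|].
    by rewrite G0 mxE.
  apply: bnd_le (@bnd_cst _ D _).
  have h : 1 <= fact_weight 0 ^+ (m + 1 + d).
    by rewrite exprn_ege1 // (le_trans _ (fact_weight_ge3 _)) // ler1n.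
  by rewrite nm_nat (le_trans _ h) //; case: (i == j); rewrite ?ler01.
have [g' hg] := choice (IH i); have [f' hf] := choice (fun k => hm k j n).
have step k := bndM (hg k) (hf k).
set B := 3 * _ in step.
have B0 : 0 <= B by rewrite !mulr_ge0 // exprn_ge0 ?ler0n.
have sumb (r : seq 'I_d) : exists h', bnd D (fun z => \sum_(k <- r) G n z i k * F n z k j) h'
    ((size r)%:R * B).
  elim: r => [|k r [h' hr]].
    exists (fun=> 0); rewrite mul0r -(nm0 R); apply: eq_bnd (@bnd_cst _ D 0) => // z _.
    by rewrite big_nil.
  eexists; rewrite /= -natr1 mulrDl mul1r addrC; apply: eq_bnd (bndD (step k) hr) => [z _|z _].
    by rewrite big_cons.
  by reflexivity.
have [h' hr] := sumb (index_enum 'I_d); exists h'.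
apply: bnd_le (eq_bnd _ _ hr) => // [|z _]; last by rewrite GS mxE.
rewrite (_ : size _ = d); last by rewrite -sum1_size -[RHS]card_ord -sum1_card; apply: eq_bigl.
have -> : fact_weight n.+1 = (n + 4)%:R * fact_weight n.
  by rewrite /fact_weight -natrM !addnS factS.
rewrite exprMn [leRHS]mulrC /B.
have -> : d%:R * (3 * (fact_weight n ^+ (m + 1 + d) * lin_weight n ^+ m)) =
  fact_weight n ^+ (m + 1 + d) * (lin_weight n ^+ m * 3 * d%:R) by ring.
rewrite ler_wpM2l ?exprn_ge0 ?ler0n // !exprD expr1 !ler_pM ?mulr_ge0 ?exprn_ge0 ?ler0n //.
- by rewrite lerXn2r ?nnegrE ?ler0n // ler_nat leq_add2l.
- by rewrite ler_nat; lia.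
- rewrite -natrX ler_nat ltnW // ltn_expl // !addnS //.
Qed.

(* The Gaussian factor [exp (- n ^ 2)] beats every power of [n!]. *)
Lemma gauss_geom (q : R) (m : nat) : 0 <= q -> q <= expR (-1) ->
  exists K, forall n, fact_weight n ^+ m * q ^+ (n ^ 2) <= K / 2 ^+ n.
Proof.
(* Put t = 2 n + 1. From [N0] on, n + 4 <= t and 2 (m + 1)! <= t; together with exp(t) >= t ^ (m +
   1) / (m + 1)! this makes the ratio of consecutive terms at most 1 / 2. *)
move=> q0 qe; pose N0 := (3 + 2 * (m.+1)`!)%N.
apply: (@geom_bound _ _ N0) => [n|n hn].
  by rewrite mulr_ge0 ?exprn_ge0 ?ler0n.
have -> : fact_weight n.+1 = (n + 4)%:R * fact_weight n.
  by rewrite /fact_weight -natrM !addnS factS.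
have -> : (n.+1 ^ 2 = n ^ 2 + (2 * n + 1))%N by rewrite -addn1 sqrnD muln1 addnAC addnA.
rewrite exprMn exprD.
rewrite (_ : 2 * _ = (2 * (n + 4)%:R ^+ m * q ^+ (2 * n + 1)) *
  (fact_weight n ^+ m * q ^+ (n ^ 2))); last by ring.
rewrite ler_piMl ?mulr_ge0 ?exprn_ge0 ?ler0n //.
set t := (2 * n + 1)%N.
have qt : q ^+ t <= (expR t%:R)^-1.
  by rewrite -expRN -mulrN1 expRM_natl lerXn2r ?nnegrE ?expR_ge0.
have f0 : 0 < m.+1`!%:R :> R by rewrite ltr0n fact_gt0.
have et : t%:R ^+ m.+1 / m.+1`!%:R <= expR t%:R :> R.
  by rewrite (le_trans _ (@expR_ge1Dxn _ t%:R m (ler0n _ _))) // lerDr.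
have t0 : (0 : R) < t%:R by rewrite ltr0n /t addn1.
have {}qt : q ^+ t <= m.+1`!%:R / t%:R ^+ m.+1.
  rewrite (le_trans qt) // -[leRHS]invrK invf_div lef_pV2 ?posrE ?expR_gt0 //.
  by rewrite divr_gt0 ?exprn_gt0.
have h1 : (n + 4)%:R ^+ m <= t%:R ^+ m :> R.
  rewrite lerXn2r ?nnegrE ?ler0n // ler_nat /t.
  have : (3 <= n)%N by apply: leq_trans hn; rewrite /N0 leq_addr.
  by lia.
have h2 : 2 * m.+1`!%:R <= t%:R :> R.
  rewrite -natrM ler_nat /t; move: hn; rewrite /N0; lia.
rewrite (@le_trans _ _ (2 * t%:R ^+ m * (m.+1`!%:R / t%:R ^+ m.+1))) //.
  by rewrite ler_pM ?mulr_ge0 ?exprn_ge0 ?ler0n // ler_pM2l.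
rewrite exprS (_ : _ * _ = 2 * m.+1`!%:R / t%:R); first by rewrite ler_pdivrMr ?mul1r.
by field; rewrite expf_neq0 ?lt0r_neq0.
Qed.

Lemma C2b_csum f (q : R) (c : nat -> R[i]) : 0 <= q -> q <= expR (-1) ->
  (forall n, nm (c n) <= q ^+ (n ^ 2)) -> sbnd fact_weight f ->
  C2b D (fun z => csum (fun n => c n * f n z)) /\
  (forall z, D z -> exists K, gsum (fun n => c n * f n z) (csum (fun n => c n * f n z)) K).
Proof.
move=> q0 qe cq [m hf]; have [K hK] := gauss_geom m q0 qe.
have [f' hf'] := choice hf.
have h n : bnd D (fun z => c n * f n z) (fun z => 0 * f n z + c n * f' n z) (3 * K / 2 ^+ n).
  apply: bnd_le (bndM (@bnd_cst _ D (c n)) (hf' n)).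
  rewrite -mulrA ler_wpM2l // (le_trans _ (hK n)) // mulrC ler_wpM2l //.
  by rewrite exprn_ge0 ?ler0n.
split; first by eexists; eexists; apply: bnd_csum h.
move=> z Dz; exists (4 * (3 * K)); apply: csum_gsum => n.
by have [] := h n z Dz.
Qed.

End SequencesOfBoundedFunctions.

(** * Uniform distance between a point and the poles of all terms *)

Section PoleFactors.
Variable R : realType.
Implicit Types (a z : R[i]).

Lemma sbnd_pole_inv W z0 (delta : R) (a : nat -> R[i]) : (forall n, 3 <= W n) ->
  0 < delta -> (forall n, a n = z0 \/ 2 * delta <= nm (z0 - a n)) ->
  sbnd (fun z => nm (z - z0) < delta) W (fun n => pole_inv z0 (a n)).
Proof.
move=> W3 d0 ha.
pose M := delta^-1 + delta^-1 ^+ 2 + delta^-1 ^+ 3 + 1.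
have [e0 e2 e3] : [/\ 0 <= delta^-1, 0 <= delta^-1 ^+ 2 & 0 <= delta^-1 ^+ 3].
  by rewrite !exprn_ge0 ?invr_ge0 ?ltW.
apply: (@sbnd_unif _ _ _ _ M) => // n; rewrite /pole_inv.
case: eqVneq => [_|ne].
  exists (fun=> 0); apply: bnd_le (@bnd_cst _ _ 1).
  by rewrite nm1 /M lerDr !addr_ge0.
have h : 2 * delta <= nm (z0 - a n) by case: (ha n) => // h; rewrite h eqxx in ne.
eexists; apply: bnd_le (bnd_shift _ (bnd_inv d0 (D := fun z => delta <= nm z) _)) => //.
  by rewrite /M lerDl.
move=> z zd /=.
have := nmD (z - a n) (z0 - z); rewrite (_ : _ + _ = z0 - a n); last by ring.
rewrite nmBC in zd; lra.
Qed.

(** A translate of the integers does not accumulate at [z0], so one disc serves the terms of every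
    index. If z0 - a is not real, its imaginary part bounds the distance; otherwise the integers
    next to it do, or the gap 1 if it is an integer. *)
Lemma lattice_sep z0 a : exists2 delta : R, 0 < delta &
  forall j : int, a + j%:~R = z0 \/ 2 * delta <= nm (z0 - (a + j%:~R)).
Proof.
have [im0|im0] := eqVneq (complex.Im (z0 - a)) 0; last first.
  exists (`|complex.Im (z0 - a)| / 2); first by rewrite divr_gt0 ?normr_gt0.
  move=> j; right; rewrite mulrCA mulfV ?pnatr_eq0 // mulr1.
  have j0 : complex.Im (j%:~R : R[i]) = 0 by rewrite -(rmorph_int (real_complex R)).
  have -> : complex.Im (z0 - a) = complex.Im (z0 - (a + j%:~R)).
    by rewrite opprD addrA [RHS]ImD [complex.Im (- _)]ImN j0 subr0.
  exact: Im_le_nm.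
set x := complex.Re (z0 - a).
have zx : z0 - a = (x%:C)%C by rewrite /x; move: im0; case: (z0 - a) => ? ? /= ->.
have nE j : nm (z0 - (a + j%:~R)) = `|x - j%:~R|.
  by rewrite opprD addrA zx -(rmorph_int (real_complex R)) -rmorphB nm_real.
have z0E (j : int) : x - j%:~R = 0 -> a + j%:~R = z0.
  by move=> h; apply/esym/eqP; rewrite -subr_eq0 -nm_eq0 nE h normr0.
have /andP[m1 m2] := floor_itv x; rewrite intrD in m2; move: m1 m2; rewrite -[1%:~R]/1.
set m := Num.floor x => m1 m2.
have [xm|xm] := eqVneq x m%:~R.
  exists (1 / 2); first by rewrite divr_gt0.
  move=> j; have [->|jm] := eqVneq j m; first by left; apply: z0E; rewrite xm subrr.
  right; rewrite nE xm -intrB -intr_norm mulrCA mulfV ?pnatr_eq0 // mulr1.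
  by rewrite ler1z -gtz0_ge1 normr_gt0 subr_eq0 eq_sym.
exists (Num.min (x - m%:~R) (m%:~R + 1 - x) / 2).
  rewrite divr_gt0 // lt_min !subr_gt0 lt_neqAle eq_sym xm m1 /=.
  exact: m2.
move=> j; right; rewrite nE mulrCA mulfV ?pnatr_eq0 // mulr1 ge_min.
have [jm|jm] := leP j m.
  have : (j%:~R : R) <= m%:~R by rewrite ler_int.
  move=> h; rewrite ger0_norm ?subr_ge0 ?(le_trans h) //.
  by rewrite lerD2l lerN2 h.
have : (m%:~R + 1 : R) <= j%:~R by rewrite -(intrD _ m 1) ler_int addrC -ltz1D ltrD2l.
move=> h; apply/orP; right; rewrite ler0_norm ?opprB ?lerD2r //.
by rewrite subr_le0 (le_trans _ h) // ltW.
Qed.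

End PoleFactors.

(** * Comparison at a center, and local factors of exp(2 pi i z) - 1 *)

Section Supplements.
Variable R : realType.
Implicit Types z w a : R[i].

Lemma csumE (u : nat -> R[i]) s K : gsum u s K -> csum u = s.
Proof.
move=> us; have uK k : nm (u k) <= 2 * K / 2 ^+ k.
  have K0 : 0 <= K.
    by have := us 0%N; rewrite expr0 divr1; apply: le_trans; apply: nm_ge0.
  have h1 := us k; have h2 := us k.+1.
  have -> : u k = (s - \sum_(i < k) u i) - (s - \sum_(i < k.+1) u i).
    by rewrite big_ord_recr /=; ring.
  rewrite (le_trans (nmB _ _)) // (le_trans (lerD h1 h2)) //.
  have : K / 2 ^+ k.+1 <= K / 2 ^+ k.
    by rewrite ler_wpM2l // lef_pV2 ?posrE ?exprn_gt0 // exprS ler_peMl ?exprn_ge0 // ler1n.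
  by rewrite -mulrA; lra.
exact: gsum_uniq (csum_gsum uK) us.
Qed.

Lemma csum_single (u : nat -> R[i]) : (forall n, u n.+1 = 0) -> csum u = u 0%N.
Proof.
move=> u0; apply: (@csumE _ _ (nm (u 0%N))) => -[|N].
  by rewrite big_ord0 subr0 expr0 divr1.
rewrite big_ord_recl big1 ?addr0 => [|i _]; last exact: u0.
by rewrite subrr nm0 divr_ge0 ?nm_ge0 ?exprn_ge0.
Qed.

Lemma sbnd_pow (D : R[i] -> Prop) W (f : R[i] -> R[i]) (e : nat -> nat) m :
  (forall n, 3 <= W n) -> C2b D f -> (forall n, (e n <= m)%N) ->
  sbnd D W (fun n z => f z ^+ e n).
Proof.
move=> W3 [f' [M fM]] em.
have {}fM : bnd D f f' (Num.max M 1) by apply: bnd_le fM; rewrite le_max lexx.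
apply: (@sbnd_unif _ _ _ _ ((3 * Num.max M 1) ^+ m)) => // n.
eexists; apply: bnd_le (bndX (e n) fM); rewrite ler_weXn2l //.
have : 1 <= Num.max M 1 by rewrite le_max lexx orbT.
lra.
Qed.

(** Continuity, in its Lipschitz form, along the points z + r / 2 ^ (k + 1). It serves to compare
    the value filled in at the center of one disc with the value computed in another. *)
Lemma C2b_eq_center (D1 D2 : R[i] -> Prop) (f g : R[i] -> R[i]) (z : R[i]) (r : R) : 0 < r ->
  (forall w, nm (w - z) < r -> D1 w) -> (forall w, nm (w - z) < r -> D2 w) ->
  C2b D1 f -> C2b D2 g ->
  (forall w, w != z -> nm (w - z) < r -> f w = g w) -> f z = g z.
Proof.
move=> r0 rD1 rD2 [f' [M fM]] [g' [N gN]] fg.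
have D1z : D1 z by apply: rD1; rewrite subrr nm0.
have D2z : D2 z by apply: rD2; rewrite subrr nm0.
apply/eqP; rewrite -subr_eq0 -nm_eq0 eq_le nm_ge0 andbT.
apply: (@le_geom _ _ ((M + N) * r)) => k.
pose h : R := r / 2 ^+ k / 2.
have h0 : 0 < h by rewrite !divr_gt0 ?exprn_gt0.
pose w := z + (h%:C)%C.
have wz : w - z = (h%:C)%C by rewrite /w addrC addKr.
have nwz : nm (w - z) = h by rewrite wz nm_real gtr0_norm.
have w1 : (1 : R) <= 2 ^+ k by rewrite exprn_ege1 // ler1n.
have hr : r / 2 ^+ k <= r by rewrite ler_pdivrMr ?exprn_gt0 // ler_peMr // ltW.
have wr : nm (w - z) < r.
  by rewrite nwz (lt_le_trans _ hr) // /h ltr_pdivrMr // ltr_pMr ?ltr1n // divr_gt0 ?exprn_gt0.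
have wz0 : w != z by rewrite -subr_eq0 -nm_eq0 nwz gt_eqF.
have [_ _ /(_ w (rD1 _ wr)) [h1 _]] := fM z D1z.
have [_ _ /(_ w (rD2 _ wr)) [h2 _]] := gN z D2z.
have M0 : 0 <= M by have [h3 _ _] := fM z D1z; apply: le_trans h3; apply: nm_ge0.
have N0 : 0 <= N by have [h3 _ _] := gN z D2z; apply: le_trans h3; apply: nm_ge0.
rewrite (fg w wz0 wr) in h1.
rewrite (_ : f z - g z = (g w - g z) - (g w - f z)); last by ring.
rewrite (le_trans (nmB _ _)) // (le_trans (lerD h2 h1)) // nwz -mulrDl addrC -mulrA.
by rewrite ler_wpM2l ?addr_ge0 // /h ler_pdivrMr // ler_peMr ?ler1n // divr_ge0 ?exprn_ge0 ?ltW.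
Qed.

Lemma sbnd_pole_inv_seq (s : seq R[i]) (z0 : R[i]) : exists2 delta : R, 0 < delta &
  forall (a : R[i]) (j : nat -> int) W, a \in s -> (forall n, 3 <= W n) ->
  forall r, r <= delta -> sbnd (fun z => nm (z - z0) < r) W
    (fun n => pole_inv z0 (a + (j n)%:~R)).
Proof.
have [delta d0 hd] : exists2 delta : R, 0 < delta & forall a, a \in s ->
    forall j : int, a + j%:~R = z0 \/ 2 * delta <= nm (z0 - (a + j%:~R)).
  elim: s => [|a s [delta d0 hd]]; first by exists 1.
  have [e e0 he] := lattice_sep z0 a.
  exists (Num.min delta e); first by rewrite lt_min d0 e0.
  move=> b; rewrite inE => /orP[/eqP->|bs] j.
    have [h|h] := he j; [by left|right; apply: le_trans h].
    by rewrite ler_pM2l // ge_min lexx orbT.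
  have [h|h] := hd b bs j; [by left|right; apply: le_trans h].
  by rewrite ler_pM2l // ge_min lexx.
exists delta => // a j W sa W3 r rd.
have [m hm] := sbnd_pole_inv W3 d0 (fun n => hd a sa (j n)).
exists m => n; have [f' hf'] := hm n; exists f' => z zr.
have [h1 h2 h3] := hf' z (lt_le_trans zr rd); split=> // w wr.
exact: h3 _ (lt_le_trans wr rd).
Qed.

Definition exp2pii (w : R[i]) := expc (twopii R * w).
Local Notation E := exp2pii.

Lemma exp2piiD (x y : R[i]) : E (x + y) = E x * E y.
Proof. by rewrite /exp2pii mulrDr expcD. Qed.

Lemma exp2pii_nat n : E (n%:R : R[i]) = 1.
Proof. by rewrite /exp2pii mulrC expcMn expc_twopii expr1n. Qed.

Lemma exp2piiN (x : R[i]) : E (- x) = (E x)^-1.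
Proof.
have h : E (- x) * E x = 1 by rewrite -exp2piiD addNr (exp2pii_nat 0).
by rewrite -[LHS]mulr1 -(mulfV (expc_neq0 (twopii R * x))) mulrA h mul1r.
Qed.

Lemma exp2pii_eq1N (x : R[i]) : (E (- x) == 1) = (E x == 1).
Proof. by rewrite exp2piiN invr_eq1. Qed.

(* [(E (z - a) - 1) / (z - z0)] with the singularity removed, when [a] is congruent to [z0]. *)
Definition exp2pii_reg z0 a z : R[i] :=
  if E (a - z0) == 1 then twopii R * expc1 (twopii R * (z - z0))
  else E (z - a) - 1.

Lemma exp2pii_regE z0 a z : E (z - a) - 1 = (z - z0) ^+ (E (a - z0) == 1) * exp2pii_reg z0 a z.
Proof.
rewrite /exp2pii_reg; case: eqP => [h|_]; last by rewrite mul1r.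
have -> : z - a = (z - z0) + - (a - z0) by ring.
rewrite exp2piiD exp2piiN h invr1 mulr1 expr1 mulrA [_ * twopii R]mulrC.
by rewrite expc1E.
Qed.

(** The zeros of exp(2 pi i z) - 1 are simple: once divided out they leave the value 2 pi i. This
    keeps the multiple of [v] taken at [c] nonzero. *)
Lemma exp2pii_reg_neq0 a z : exp2pii_reg z a z != 0.
Proof.
rewrite /exp2pii_reg; case: (E (a - z) =P 1) => [_|h]; first by rewrite subrr mulr0 expc1_0 mulr1 twopii_neq0.
by rewrite subr_eq0 -exp2pii_eq1N opprB; apply/eqP.
Qed.

Lemma C2b_id (D : R[i] -> Prop) z0 (r : R) : (forall z, D z -> nm (z - z0) < r) -> C2b D id.
Proof.
move=> Dr; exists (fun=> 1), (nm z0 + r + 1); apply: bnd_id => z /Dr zr.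
rewrite (_ : z = z0 + (z - z0)); last by rewrite addrC subrK.
by rewrite (le_trans (nmD _ _)) // lerD2l ltW.
Qed.

Lemma C2b_exp2pii_reg (D : R[i] -> Prop) z0 (r : R) a b : (forall z, D z -> nm (z - b) < r) ->
  C2b D (exp2pii_reg z0 a).
Proof.
move=> Dr; have hid := C2b_id Dr.
have lin x y : C2b D (fun z => x * (z - y)).
  by apply: C2bM (C2b_cst _ _) (C2bD hid (C2b_cst _ _)).
rewrite /exp2pii_reg; case: eqP => _.
  by apply: C2bM (C2b_cst _ _) (C2b_expc1 (lin _ _)).
by apply: C2bD (C2b_expc (lin _ _)) (C2b_cst _ _).
Qed.

End Supplements.

Section VectorSums.
Variables (R : realType) (d : nat).
Implicit Types (u w : nat -> 'cV[R[i]]_d) (s t : 'cV[R[i]]_d).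

Definition vcsum u : 'cV[R[i]]_d := \col_i csum (fun n => u n i 0).
Definition vgsum u s := forall i, exists K, gsum (fun n => u n i 0) (s i 0) K.

Lemma vcsumE u s : vgsum u s -> vcsum u = s.
Proof.
move=> us; apply/colP => i; rewrite mxE; have [K hK] := us i.
exact: csumE hK.
Qed.

Lemma vgsumM u s (M : 'M[R[i]]_d) : vgsum u s -> vgsum (fun n => M *m u n) (M *m s).
Proof.
move=> us i; have [K hK] := choice us.
exists (\sum_k nm (M i k) * K k); rewrite mxE.
have := gsum_sum (index_enum 'I_d) (fun k => gsumZ (M i k) (hK k)).
congr gsum; apply: funext => n; by rewrite mxE.
Qed.

Lemma vgsumS u s : vgsum u s -> vgsum (fun n => u n.+1) (s - u 0%N).
Proof.
move=> us i; have [K hK] := us i; exists K; rewrite !mxE.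
exact: gsumS hK.
Qed.

Lemma vgsum_uniq u s t : vgsum u s -> vgsum u t -> s = t.
Proof. by move=> /vcsumE <- /vcsumE. Qed.

End VectorSums.

(** * Convergence of the Poincare series *)

Section WeightedBounds.
Variable R : realType.
Variable D : R[i] -> Prop.

(** If 3 M <= 3 ^ k then (3 M) ^ n <= (3 ^ n) ^ k, and 3 ^ n <= (n + 3)!. *)
Lemma sbnd_geom (u : R[i] -> R[i]) : C2b D u -> sbnd D (@fact_weight R) (fun n z => u z ^+ n).
Proof.
move=> [u' [M uM]]; pose k := (Num.truncn (3 * M)).+1; exists k => n.
have Mk : 3 * M <= k%:R by rewrite ltW // truncnS_gt.
(* A negative [M] forces [D] to be empty. *)
have [M0|M0] := leP 0 M; last first.
  exists (fun=> 0) => z Dz; have [h _ _] := uM z Dz.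
  by have := le_lt_trans (le_trans (nm_ge0 _) h) M0; rewrite ltxx.
eexists; apply: bnd_le (bndX n uM).
have M3 : 0 <= 3 * M by rewrite mulr_ge0.
have k3 : 3 * M <= 3 ^+ k.
  by rewrite (le_trans Mk) // -natrX ler_nat ltnW // ltn_expl.
rewrite (@le_trans _ _ ((3 ^+ k) ^+ n)) //.
  by rewrite lerXn2r ?nnegrE ?exprn_ge0.
rewrite exprAC lerXn2r ?nnegrE ?exprn_ge0 ?ler0n //.
rewrite -natrX ler_nat; elim: (n) => [//|m IH].
rewrite expnS addSn factS leq_mul //; lia.
Qed.

Lemma sbnd_horner (p : {poly R[i]}) (x : nat -> R[i] -> R[i]) :
  sbnd D (@lin_weight R) x -> sbnd D (@lin_weight R) (fun n z => p.[x n z]).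
Proof.
move=> hx; have W3 := @lin_weight_ge3 R.
have h : sbnd D (@lin_weight R) (fun n z => \sum_(i < size p) p`_i * x n z ^+ i).
  apply: (@sbnd_sum R D (@lin_weight R) _ _ (fun (i : 'I_(size p)) n z => p`_i * x n z ^+ i)) => // i.
  exact: sbndM W3 (sbnd_cst W3 (C2b_cst D _)) (sbndX _ W3 hx).
by apply: eq_sbnd h => n z _; rewrite horner_coef.
Qed.

Lemma sbnd_translate (s : R[i]) : C2b D id ->
  sbnd D (@lin_weight R) (fun n z => z + s * n%:R).
Proof.
move=> hid; have W3 := @lin_weight_ge3 R.
apply: (sbndD W3 (sbnd_cst W3 hid)).
exact: sbndM W3 (sbnd_cst W3 (C2b_cst D s)) (sbnd_nat D).
Qed.

Lemma sbnd_C2b W (f : nat -> R[i] -> R[i]) n : sbnd D W f -> C2b D (f n).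
Proof. by move=> [m /(_ n) [f' h]]; exists f', (W n ^+ m). Qed.

End WeightedBounds.

(** * The solution near a point of the half-plane *)

Section LocalSolution.
Variables (R : realType) (d : nat) (P : 'M[{poly R[i]}]_d) (q : {poly R[i]}).
Variables (lq lb : R[i]) (rq rb : seq R[i]) (lam : R) (c : R[i]) (v : 'cV[R[i]]_d).
Implicit Types z w a : R[i].
Hypothesis lq0 : lq != 0.
Hypothesis lb0 : lb != 0.
Hypothesis qE : q = lq *: \prod_(r <- rq) ('X - r%:P).
Hypothesis detE : \det P = lb *: \prod_(p <- rb) ('X - p%:P).
Hypothesis rq_lam : forall r : R[i], r \in rq -> lam <= complex.Re r.
Hypothesis rb_lam : forall p : R[i], p \in rb -> lam <= complex.Re p.
Definition half_plane z : Prop := complex.Re z < lam.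
Hypothesis c_lam : half_plane c.

Local Notation E := (@exp2pii R).
Local Notation ex := (@expc R).
Local Notation GL := (left_prod P q).
Local Notation GK := (right_prod_reg P q lb rb).
Local Notation Lt := (left_term E ex P q rb c v).
Local Notation Rt := (right_term E ex P q lb rb c v).
Local Notation LF := (left_reg E ex P q rb c v).
Local Notation RF := (right_reg E ex P q lb rb c v).
Local Notation qc := (gauss_coeff ex).
Local Notation pfac := (periodic_factor E rb c).
Local Notation phis := (seed E ex rb c).
Local Notation mult := (cleared_order E rb c).

Let rqH : forall r : R[i], r \in rq -> ~ half_plane r.
Proof. by move=> r /rq_lam h; rewrite /half_plane ltNge h. Qed.
Let rbH : forall r : R[i], r \in rb -> ~ half_plane r.
Proof. by move=> r /rb_lam h; rewrite /half_plane ltNge h. Qed.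
Lemma half_plane_sub z n : half_plane z -> half_plane (z - n%:R).
Proof.
by move=> hz; rewrite /half_plane ReD ReN Re_nat (le_lt_trans _ hz) // gerBl.
Qed.

(** The term of index 0 occurs in both series, hence the subtraction. *)
Definition poincare_sum z := vcsum (Lt^~ z) + vcsum (Rt^~ z) - phis z *: v.
Definition raw_solution z := pfac z *: poincare_sum z.

Lemma nm_gauss_coeff n : nm (qc n) <= expR (-1) ^+ (n ^ 2).
Proof.
have -> : qc n = ex (-1) ^+ (n ^ 2).
  by rewrite -expcMn /qc mulrN1 natrX expr2.
rewrite nmX (_ : -1 = ((-1)%:C)%C); last by rewrite rmorphN.
by rewrite expc_real nm_real ger0_norm ?expR_ge0.
Qed.

(** Multiplication by A(z) moves the index by one. It sends the whole left series at z to the left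
    series at z + 1 without its term of index 0, and the right series at z without its term of index
    0 to the whole right series at z + 1. In [poincare_sum] the missing terms are exactly the
    subtracted ones. *)
Lemma raw_solution_shift z sl sr sl' sr' : half_plane z ->
  vgsum (Lt^~ z) sl -> vgsum (Rt^~ z) sr ->
  vgsum (Lt^~ (z + 1)) sl' -> vgsum (Rt^~ (z + 1)) sr' ->
  raw_solution (z + 1) = step_mx P q z *m raw_solution z.
Proof.
move=> hz hl hr hl' hr'.
have TE x s t : vgsum (Lt^~ x) s -> vgsum (Rt^~ x) t -> poincare_sum x = s + t - phis x *: v.
  by move=> h1 h2; apply: congr2 (congr2 _ (vcsumE h1) (vcsumE h2)) (erefl _).
apply: periodic_factor_step; [exact: exp2piiD|exact: (exp2pii_nat R 1)|].
have T1 := TE _ _ _ hl hr; have T2 := TE _ _ _ hl' hr'.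
have Lt0 x : Lt 0 x = phis x *: v by rewrite /left_term subr0 mul1mx.
have Rt0 x : Rt 0 x = phis x *: v by rewrite /right_term addr0 mul1mx.
have e1 : sl' - phis (z + 1) *: v = step_mx P q z *m sl.
  rewrite -Lt0; apply: vgsum_uniq (vgsumS hl') _.
  have h := vgsumM (step_mx P q z) hl; move: h; congr vgsum; apply: funext => n.
  by rewrite -left_termS.
have e2 : sr' = step_mx P q z *m (sr - phis z *: v).
  rewrite -Rt0; apply: vgsum_uniq hr' _.
  have h := vgsumM (step_mx P q z) (vgsumS hr); move: h; congr vgsum; apply: funext => n.
  exact: (right_termS _ _ _ _ lq0 lb0 qE detE rqH rbH).
by rewrite T2 T1 addrAC e1 e2 -mulmxDr addrA.
Qed.

Variables (z0 : R[i]) (delta : R).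
Hypothesis z0H : half_plane z0.
Let D z : Prop := nm (z - z0) < delta.
Hypothesis hpole : forall a (j : nat -> int) W, a \in c :: rq ++ rb ->
  (forall n, 3 <= W n) -> sbnd D W (fun n => pole_inv z0 (a + (j n)%:~R)).

Let hid : C2b D id.
Proof. by apply: (@C2b_id _ _ z0 delta). Qed.

Let Wl := @lin_weight_ge3 R.
Let Wf := @fact_weight_ge3 R.

Lemma sbnd_left_prod i j : sbnd D (@fact_weight R) (fun n z => GL n z i j).
Proof.
apply: (@sbnd_partial_prod R D d (fun n z => step_mx P q (z - n.+1%:R)) GL) => // {}i {}j.
have hP : sbnd D (@lin_weight R) (fun n z => (P i j).[z - n.+1%:R]).
  apply: sbnd_horner.
  have := sbndD Wl (sbnd_translate (-1) hid) (sbnd_cst Wl (C2b_cst D (-1))).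
  by apply: eq_sbnd => n z _; rewrite -natr1; ring.
have hq : sbnd D (@lin_weight R)
    (fun n z => \prod_(r <- rq) pole_inv z0 (r + (n.+1%:Z)%:~R) z).
  apply: (@sbnd_prod R D (@lin_weight R) _ _ (fun r n z => pole_inv z0 (r + (n.+1%:Z)%:~R) z)) => // r rrq.
  by apply: (hpole (fun n => n.+1%:Z)) => //; rewrite inE mem_cat rrq orbT.
have := sbndM Wl (sbndM Wl (sbnd_cst Wl (C2b_cst D lq^-1)) hq) hP.
apply: eq_sbnd => n z _ /=; rewrite /step_mx !mxE /horner_eval; congr (_ * _).
rewrite (denominatorE qE) invfM -prodfV; congr (_ * _); apply: eq_big_seq => r rrq.
(* A root r of q with z0 = r + n + 1 would lie to the left of [z0], inside the half-plane; so
   [pole_inv] is a genuine inverse here. *)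
rewrite /pole_inv ifN; last first.
  apply/eqP => z0E; apply: (rqH rrq).
  have -> : r = z0 - n.+1%:R by rewrite z0E addrK.
  exact: half_plane_sub.
by congr (_^-1); rewrite opprD addrA addrAC.
Qed.

Lemma sbnd_right_prod_reg i j : sbnd D (@fact_weight R) (fun n z => GK z0 n z i j).
Proof.
apply: (@sbnd_partial_prod R D d
  (fun n z => (\prod_(p <- rb) pole_inv z0 (p - n%:R) z) *: inv_step_num P q lb (z + n%:R))
  (GK z0)) => // {}i {}j.
have hz : sbnd D (@lin_weight R) (fun n z => z + n%:R).
  by have := sbnd_translate 1 hid; apply: eq_sbnd => n z _; rewrite mul1r.
have hq := sbnd_horner q hz; have hP := sbnd_horner (\adj P i j) hz.
have hb : sbnd D (@lin_weight R) (fun n z => \prod_(p <- rb) pole_inv z0 (p - n%:R) z).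
  apply: (@sbnd_prod R D (@lin_weight R) _ _ (fun p n z => pole_inv z0 (p - n%:R) z)) => // p prb.
  have := hpole (a := p) (fun n => - n%:Z) (W := @lin_weight R).
  rewrite inE mem_cat prb !orbT => /(_ isT Wl).
  by apply: eq_sbnd => n z _; rewrite mulrNz.
have := sbndM Wl hb (sbndM Wl (sbndM Wl (sbnd_cst Wl (C2b_cst D lb^-1)) hq) hP).
by apply: eq_sbnd => n z _ /=; rewrite /inv_step_num !mxE /horner_eval.
Qed.

Let hgauss : C2b D (fun z => ex (- (z * z))).
Proof.
apply: C2b_expc.
by apply: eq_C2b (C2bM (C2b_cst D (-1)) (C2bM hid hid)) => z _; rewrite mulN1r.
Qed.

Let hlin a : C2b D (fun z => ex (a * z)).
Proof. by apply: C2b_expc; apply: C2bM (C2b_cst D a) hid. Qed.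

Let hz0 : C2b D (fun z => z - z0).
Proof. exact: C2bD hid (C2b_cst D _). Qed.

Let hvec (G : nat -> R[i] -> 'M[R[i]]_d) i :
  (forall i j, sbnd D (@fact_weight R) (fun n z => G n z i j)) ->
  sbnd D (@fact_weight R) (fun n z => (G n z *m v) i 0).
Proof.
move=> hG; have h : sbnd D (@fact_weight R) (fun n z => \sum_j G n z i j * v j 0).
  apply: (@sbnd_sum R D (@fact_weight R) _ _ (fun j n z => G n z i j * v j 0)) => // j.
  exact: sbndM Wf (hG i j) (sbnd_cst Wf (C2b_cst D _)).
by apply: eq_sbnd h => n z _; rewrite mxE.
Qed.

Lemma sbnd_left_reg i : sbnd D (@fact_weight R) (fun n z => LF z0 n z i).
Proof.
have hp : sbnd D (@fact_weight R) (fun n z => pole_inv z0 (c + n%:R) z).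
  by apply: (hpole (fun n => n%:Z)) => //; rewrite mem_head.
exact: sbndM Wf (sbndM Wf (sbndM Wf (sbndM Wf (sbnd_cst Wf hgauss)
  (sbnd_geom (hlin 2))) (sbndX _ Wf hp)) (sbnd_pow Wf hz0 (fun n => leq_subr _ (mult z0))))
  (hvec i sbnd_left_prod).
Qed.

Lemma sbnd_right_reg i : sbnd D (@fact_weight R) (fun n z => RF z0 n z i).
Proof.
have hp : sbnd D (@fact_weight R) (fun n z => pole_inv z0 (c - n%:R) z).
  have := hpole (a := c) (fun n => - n%:Z) (W := @fact_weight R) (mem_head _ _) Wf.
  by apply: eq_sbnd => n z _; rewrite mulrNz.
have h2 : C2b D (fun z => ex (- (2 * z))).
  by apply: eq_C2b (hlin (-2)) => z _; rewrite mulNr.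
exact: sbndM Wf (sbndM Wf (sbndM Wf (sbndM Wf (sbnd_cst Wf hgauss)
  (sbnd_geom h2)) (sbndX _ Wf hp)) (sbnd_pow Wf hz0 (fun n => leq_subr _ (mult z0))))
  (hvec i sbnd_right_prod_reg).
Qed.

(* At [z0 = c] every regularized term but the one of index 0 vanishes, which is
   how the value of the solution at [c] is prescribed. *)
Lemma local_solution : exists F : R[i] -> 'cV[R[i]]_d,
  [/\ forall i, C2b D (fun z => F z i 0),
      forall z, D z -> z != z0 ->
        [/\ exists s, vgsum (Lt^~ z) s, exists s, vgsum (Rt^~ z) s & F z = raw_solution z] &
      z0 = c -> exists2 g, g != 0 & F z0 = g *: v].
Proof.
have e0 : 0 <= expR (-1) :> R by rewrite expR_ge0.
have hL i := C2b_csum e0 (lexx _) nm_gauss_coeff (sbnd_left_reg i).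
have hR i := C2b_csum e0 (lexx _) nm_gauss_coeff (sbnd_right_reg i).
pose SL z i := csum (fun n => qc n * LF z0 n z i).
pose SR z i := csum (fun n => qc n * RF z0 n z i).
pose S z : 'cV[R[i]]_d := \col_i (SL z i + SR z i + - (qc 0 * LF z0 0 z i)).
have SE z i : S z i 0 = SL z i + SR z i + - (qc 0 * LF z0 0 z i) by rewrite mxE.
have colZ a (u : 'cV[R[i]]_d) i : (a *: u) i 0 = a * u i 0 by rewrite mxE.
have colDB (f g : 'I_d -> R[i]) (u : 'cV[R[i]]_d) i :
  (\col_i f i + \col_i g i - u) i 0 = f i + g i - u i 0 by rewrite !mxE.
have fin (x y w u : R[i]) : x = u -> y = u -> w = u -> x + y - w = u.
  by move=> -> -> ->; rewrite addrK.
(* The periodic factor without its zero at [z0]; the power of (z - z0) taken out is the one already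
   spent on the poles of the terms. *)
pose N z := \prod_(p <- rb) exp2pii_reg z0 p z * exp2pii_reg z0 c z.
exists (fun z => N z *: S z); split.
- move=> i; have hN : C2b D N.
    apply: C2bM; last exact: (@C2b_exp2pii_reg _ D z0 delta c z0).
    apply: (@C2b_prod _ D _ _ (fun p z => exp2pii_reg z0 p z)) => p.
    by apply: (@C2b_exp2pii_reg _ D z0 delta p z0).
  have h0 : C2b D (fun z => - (qc 0 * LF z0 0 z i)).
    have := C2bM (C2b_cst D (- qc 0)) (sbnd_C2b 0 (sbnd_left_reg i)).
    by apply: eq_C2b => z _; rewrite mulNr.
  have := C2bM hN (C2bD (C2bD (hL i).1 (hR i).1) h0).
  by apply: eq_C2b => z _; rewrite !mxE.
- move=> z Dz zz; pose w := (z - z0) ^+ mult z0.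
  have w0 : w != 0 by rewrite expf_neq0 // subr_eq0.
  have LtE n i : Lt n z i 0 = w^-1 * (qc n * LF z0 n z i).
    rewrite -(left_regE P q rb c v (@exp2piiD R) (exp2pii_nat R 1) (@expcD R) (expc0 R) n i zz).
    by rewrite mulKf.
  have RtE n i : Rt n z i 0 = w^-1 * (qc n * RF z0 n z i).
    rewrite -(right_regE P q lb v (@exp2piiD R) (exp2pii_nat R 1) (@expcD R) (expc0 R) rbH half_plane_sub c_lam n i zz).
    by rewrite mulKf.
  have gL : vgsum (Lt^~ z) (\col_i (w^-1 * SL z i)).
    move=> i; have [K hK] := (hL i).2 z Dz; exists (nm w^-1 * K).
    rewrite mxE; have := gsumZ w^-1 hK; congr gsum; apply: funext => n; by rewrite LtE.
  have gR : vgsum (Rt^~ z) (\col_i (w^-1 * SR z i)).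
    move=> i; have [K hK] := (hR i).2 z Dz; exists (nm w^-1 * K).
    rewrite mxE; have := gsumZ w^-1 hK; congr gsum; apply: funext => n; by rewrite RtE.
  split; [by eexists; exact: gL|by eexists; exact: gR|].
  have TS : poincare_sum z = w^-1 *: S z.
    transitivity ((\col_i (w^-1 * SL z i)) + (\col_i (w^-1 * SR z i)) - phis z *: v).
      exact: congr2 (congr2 _ (vcsumE gL) (vcsumE gR)) (erefl _).
    have -> : phis z *: v = Lt 0 z by rewrite /left_term subr0 mul1mx.
    apply/colP => i; transitivity (w^-1 * SL z i + w^-1 * SR z i - Lt 0 z i 0).
      exact: colDB.
    rewrite LtE -mulrN -2!mulrDr; apply/esym.
    exact: etrans (colZ _ _ _) (congr1 _ (SE _ _)).
  have NE : pfac z = w * N z.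
    by apply: periodic_factorE => a; exact: exp2pii_regE.
  by rewrite /raw_solution TS scalerA NE mulrAC mulfV // mul1r.
(* Both sums and the subtracted term equal exp(- c ^ 2) v at the center, so one copy is left. *)
move=> zc; exists (N z0 * ex (- (z0 * z0))).
  rewrite mulf_neq0 ?expc_neq0 // /N zc mulf_neq0 ?exp2pii_reg_neq0 //.
  rewrite prodf_seq_neq0; apply/allP => p _ /=; exact: exp2pii_reg_neq0.
rewrite -scalerA; congr (_ *: _).
have LF0 := left_reg_center0 P q rb v (@exp2piiD R) (exp2pii_nat R 1) (expc0 R) zc.
have RF0 := right_reg_center0 P q lb rb v (@exp2piiD R) (exp2pii_nat R 1) (expc0 R) zc.
have LFS n i : qc n.+1 * LF z0 n.+1 z0 i = 0.
  by apply: left_reg_centerS; [exact: exp2piiD|exact: (exp2pii_nat R 1)|exact: zc].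
have RFS n i : qc n.+1 * RF z0 n.+1 z0 i = 0.
  by apply: right_reg_centerS; [exact: exp2piiD|exact: (exp2pii_nat R 1)|exact: zc].
have SLE i : SL z0 i = ex (- (z0 * z0)) * v i 0.
  exact: etrans (@csum_single R (fun n => qc n * LF z0 n z0 i) (fun n => LFS n i)) (LF0 i).
have SRE i : SR z0 i = ex (- (z0 * z0)) * v i 0.
  exact: etrans (@csum_single R (fun n => qc n * RF z0 n z0 i) (fun n => RFS n i)) (RF0 i).
apply/colP => i; apply: etrans (SE z0 i) _; apply: etrans (esym (colZ _ _ _)).
exact: fin (SLE i) (SRE i) (LF0 i).
Qed.

End LocalSolution.

(** * Solutions on a left half-plane *)

Section GlobalSolution.
Variables (R : realType) (d : nat) (P : 'M[{poly R[i]}]_d) (q : {poly R[i]}).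
Variables (lq lb : R[i]) (rq rb : seq R[i]) (lam : R) (c : R[i]) (v : 'cV[R[i]]_d).
Implicit Types z w a : R[i].
Hypothesis lq0 : lq != 0.
Hypothesis lb0 : lb != 0.
Hypothesis qE : q = lq *: \prod_(r <- rq) ('X - r%:P).
Hypothesis detE : \det P = lb *: \prod_(p <- rb) ('X - p%:P).
Hypothesis rq_lam : forall r : R[i], r \in rq -> lam <= complex.Re r.
Hypothesis rb_lam : forall p : R[i], p \in rb -> lam <= complex.Re p.
Local Notation half_plane := (half_plane lam).
Hypothesis c_lam : half_plane c.

Local Notation Lt := (left_term (@exp2pii R) (@expc R) P q rb c v).
Local Notation Rt := (right_term (@exp2pii R) (@expc R) P q lb rb c v).
Local Notation Y0 := (raw_solution P q lb rb c v).

(** The hypothesis on [z0] stands inside the existential so that [choice] yields a radius and a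
    local solution for all points at once. *)
Let localP z0 : exists rF : R * (R[i] -> 'cV[R[i]]_d), half_plane z0 ->
  [/\ 0 < rF.1, forall w, nm (w - z0) < rF.1 -> half_plane w,
      forall i, C2b (fun w => nm (w - z0) < rF.1) (fun w => rF.2 w i 0),
      forall w, nm (w - z0) < rF.1 -> w != z0 ->
        [/\ exists s, vgsum (Lt^~ w) s, exists s, vgsum (Rt^~ w) s & rF.2 w = Y0 w] &
      z0 = c -> exists2 g, g != 0 & rF.2 z0 = g *: v].
Proof.
have [hz|nhz] := pselect (half_plane z0); last by exists (0, fun=> 0).
have [delta d0 hd] := sbnd_pole_inv_seq (c :: rq ++ rb) z0.
pose r := Num.min delta (lam - complex.Re z0).
have rd : r <= delta by rewrite ge_min lexx.
have [F [h1 h2 h3]] := local_solution P lb v qE rq_lam rb_lam c_lam hz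
  (fun a j W ha hW => hd a j W ha hW r rd).
exists (r, F) => _; split=> //=.
  by rewrite lt_min d0 subr_gt0.
move=> w wr; have /andP[_ wl] : (nm (w - z0) < delta) && (nm (w - z0) < lam - complex.Re z0).
  by rewrite -lt_min.
have := le_lt_trans (ler_norm _) (le_lt_trans (Re_le_nm (w - z0)) wl).
by rewrite ReD ReN ltrD2r.
Qed.

Lemma half_plane_solution : exists Y : R[i] -> 'cV[R[i]]_d,
  [/\ forall z i, half_plane z -> holomorphic_at (fun w => Y w i 0) z,
      forall z, half_plane z -> half_plane (z + 1) -> exists2 r : R, 0 < r &
        forall w, w != z -> nm (w - z) < r ->
          half_plane w /\ Y (w + 1) = step_mx P q w *m Y w &
      exists2 g, g != 0 & Y c = g *: v].
Proof.
have [rF hF] := choice localP.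
pose Y z := (rF z).2 z.
have YE z w : half_plane z -> nm (w - z) < (rF z).1 -> Y w = (rF z).2 w.
  move=> hz wr; have [->//|wz] := eqVneq w z.
  have [r0 hr C2z Yz _] := hF z hz; have hw := hr w wr.
  have [r0w hrw C2w Yw _] := hF w hw.
  (* The last entry keeps [z] out of the disc around [w]. Away from [w] both local solutions then
     coincide there with [raw_solution], hence they agree at [w] too. *)
  pose r := Num.min (rF w).1 (Num.min ((rF z).1 - nm (w - z)) (nm (w - z))).
  have r_gt0 : 0 < r by rewrite !lt_min r0w subr_gt0 wr nm_gt0 subr_eq0 wz.
  have rP x : nm (x - w) < r -> [/\ nm (x - w) < (rF w).1, nm (x - z) < (rF z).1 & x != z].
    rewrite !lt_min => /and3P[x1 x2 x3]; split=> //.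
      rewrite (_ : x - z = (x - w) + (w - z)); last by rewrite addrA subrK.
      by rewrite (le_lt_trans (nmD _ _)) // -ltrBrDr.
    by apply: contraTneq x3 => ->; rewrite nmBC ltxx.
  apply/colP => i.
  apply: (C2b_eq_center r_gt0 _ _ (C2w i) (C2z i)) => x.
  - by move=> /rP[].
  - by move=> /rP[].
  move=> xw /rP[x1 x2 x3].
  by have [_ _ ->] := Yw x x1 xw; have [_ _ ->] := Yz x x2 x3.
exists Y; split.
- move=> z i hz; have [r0 hr C2z _ _] := hF z hz.
  apply: (C2b_holomorphic r0); apply: eq_C2b (C2z i) => w wr.
  by rewrite (YE z).
- move=> z hz hz1; have [r0 hr _ Yz _] := hF z hz.
  have [r1 _ _ Yz1 _] := hF _ hz1.
  exists (Num.min (rF z).1 (rF (z + 1)).1); first by rewrite lt_min r0 r1.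
  move=> w wz; rewrite lt_min => /andP[wr wr1]; split; first exact: hr.
  have e : w + 1 - (z + 1) = w - z by rewrite opprD addrACA subrr addr0.
  have w1r : nm (w + 1 - (z + 1)) < (rF (z + 1)).1 by rewrite e.
  have w1z : w + 1 != z + 1 by rewrite -subr_eq0 e subr_eq0.
  have [[s hs] [t ht] Yw] := Yz w wr wz.
  have [[s1 hs1] [t1 ht1] Yw1] := Yz1 (w + 1) w1r w1z.
  rewrite (YE z w hz wr) (YE _ _ hz1 w1r) Yw Yw1.
  exact: (raw_solution_shift lq0 lb0 qE detE rq_lam rb_lam (hr w wr) hs ht hs1 ht1).
have [_ _ _ _ hc] := hF c c_lam; exact: hc.
Qed.

End GlobalSolution.

(** * Limits and rational functions *)

Section PuncturedLimits.
Variable K : numFieldType.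
Implicit Types (f g : K^o -> K^o) (z : K^o) (l : K^o).

Definition plim f z l := f w @[w --> z^'] --> l.

Lemma plim_cst z l : plim (fun=> l) z l.
Proof. exact: cvg_cst. Qed.

Lemma plimD f g z l (m : K^o) : plim f z l -> plim g z m -> plim (fun w => f w + g w) z (l + m).
Proof. exact: cvgD. Qed.

Lemma plimM f g z l (m : K^o) : plim f z l -> plim g z m -> plim (fun w => f w * g w) z (l * m).
Proof. exact: cvgM. Qed.

Lemma plimV f z l : l != 0 -> plim f z l -> plim (fun w => (f w)^-1) z l^-1.
Proof. move=> l0; exact: cvgV. Qed.

Lemma plim_uniq f z l (m : K^o) : plim f z l -> plim f z m -> l = m.
Proof. move=> h1 h2; apply: (cvg_unique _ h1 h2); exact: norm_hausdorff. Qed.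

Lemma eq_plim f g z l : (\forall w \near z^', f w = g w) -> plim f z l -> plim g z l.
Proof. move=> fg; apply: cvg_trans; exact: near_eq_cvg. Qed.

Lemma plim_shift f z s : {for (z + s : K^o), continuous f} ->
  plim (fun w => f (w + s)) z (f (z + s)).
Proof.
move=> cf; apply: cvg_within_filter.
apply: (@cvg_comp _ _ _ (fun w : K^o => w + s) f _ (nbhs (z + s : K^o))) => //.
apply: cvgD; [exact: cvg_id|exact: cvg_cst].
Qed.

Lemma derivable1_continuous f z : derivable f z 1 -> {for z, continuous f}.
Proof. by move=> /derivable1_diffP; apply: differentiable_continuous. Qed.

Lemma plim_sum (I : Type) (r : seq I) (F : I -> K^o -> K^o) (L : I -> K^o) z :
  (forall i, plim (F i) z (L i)) ->
  plim (fun w => \sum_(i <- r) F i w) z (\sum_(i <- r) L i).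
Proof.
move=> h; elim: r => [|i r IH].
  rewrite big_nil (_ : (fun w => _) = fun=> 0); first exact: plim_cst.
  by apply: funext => w; rewrite big_nil.
rewrite big_cons (_ : (fun w => _) = fun w => F i w + \sum_(j <- r) F j w).
  exact: plimD.
by apply: funext => w; rewrite big_cons.
Qed.

Definition mlim m n (F : K -> 'M[K]_(m, n)) (z : K) (M : 'M[K]_(m, n)) :=
  forall i j, plim (fun w => F w i j) z (M i j).

Lemma mlimM m n p (F : K -> 'M[K]_(m, n)) (G : K -> 'M[K]_(n, p)) z M N :
  mlim F z M -> mlim G z N -> mlim (fun w => F w *m G w) z (M *m N).
Proof.
move=> hF hG i j; rewrite mxE (_ : (fun w => _) = fun w => \sum_k F w i k * G w k j).
  by apply: plim_sum => k; apply: plimM.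
by apply: funext => w; rewrite mxE.
Qed.

Lemma mlimZ m n (f : K -> K) (l : K) (F : K -> 'M[K]_(m, n)) z M :
  plim f z l -> mlim F z M -> mlim (fun w => f w *: F w) z (l *: M).
Proof.
move=> hf hF i j; rewrite mxE (_ : (fun w => _) = fun w => f w * F w i j).
  exact: plimM.
by apply: funext => w; rewrite mxE.
Qed.

Lemma mlim_uniq m n (F : K -> 'M[K]_(m, n)) z M N : mlim F z M -> mlim F z N -> M = N.
Proof. by move=> h1 h2; apply/matrixP => i j; apply: plim_uniq (h1 i j) (h2 i j). Qed.

Lemma eq_mlim m n (F G : K -> 'M[K]_(m, n)) (z : K) M :
  (\forall w \near (z : K^o)^', F w = G w) -> mlim F z M -> mlim G z M.
Proof.
move=> FG hF i j; apply: eq_plim (hF i j); near=> w.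
by congr (fun_of_matrix _ i j); near: w.
Unshelve. all: by end_near. Qed.

Lemma plim_horner (p : {poly K}) (z s : K) : plim (fun w => p.[w + s]) z p.[z + s].
Proof.
elim/poly_ind: p => [|p c IH].
  rewrite horner0 (_ : (fun w => _) = fun=> 0); first exact: plim_cst.
  by apply: funext => w; rewrite horner0.
rewrite hornerMXaddC (_ : (fun w => _) = fun w => p.[w + s] * (w + s) + c).
  apply: plimD; last exact: plim_cst.
  apply: plimM => //; apply: (@plim_shift id); exact: cvg_id.
by apply: funext => w; rewrite hornerMXaddC.
Qed.

Lemma plim_rat_eval (f : {fraction {poly K}}) (z s : K) :
  rat_pole_order f (z + s) = 0%N -> plim (fun w => rat_eval f (w + s)) z (rat_eval f (z + s)).
Proof.
move=> f0; apply: plimM; first exact: plim_horner.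
apply: plimV; last exact: plim_horner.
rewrite -rootE -dvdp_XsubCl XsubC_dvd ?rat_den_neq0 //.
by rewrite -/(rat_pole_order f (z + s)) f0.
Qed.

Lemma mlim_mx_eval d (A : 'M[{fraction {poly K}}]_d) (z s : K) : ~ is_pole A (z + s) ->
  mlim (fun w => mx_eval A (w + s)) z (mx_eval A (z + s)).
Proof.
move=> hA i j; rewrite mxE.
rewrite (_ : (fun w => _) = fun w => rat_eval (A i j) (w + s)); last first.
  by apply: funext => w; rewrite mxE.
apply: plim_rat_eval; apply/eqP; rewrite -leqn0 -[0%N]/(0%N).
have A0 : mx_pole_order A (z + s) = 0%N.
  by apply/eqP; rewrite -leqn0 leqNgt; apply/negP.
rewrite -A0 /mx_pole_order (leq_trans _ (leq_bigmax i)) //.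
exact: (leq_bigmax (F := fun j => rat_pole_order (A i j) (z + s)) j).
Qed.

Lemma mlim_prod_mx_eval d (A : 'M[{fraction {poly K}}]_d) (z : K) n :
  (forall j : nat, (0 < j)%N -> ~ is_pole A (z - j%:R)) ->
  mlim (fun w => \prod_(1 <= j < n.+1) mx_eval A (w - j%:R)) z
    (\prod_(1 <= j < n.+1) mx_eval A (z - j%:R)).
Proof.
move=> hA; elim: n => [|n IH].
  rewrite big_geq // (_ : (fun w => _) = fun=> 1).
    by move=> i j; apply: plim_cst.
  by apply: funext => w; rewrite big_geq.
rewrite big_nat_recr //= (_ : (fun w => _) = fun w =>
    \prod_(1 <= j < n.+1) mx_eval A (w - j%:R) *m mx_eval A (w - n.+1%:R)).
  by apply: mlimM IH (mlim_mx_eval (hA _ _)).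
by apply: funext => w; rewrite big_nat_recr.
Qed.

End PuncturedLimits.

(** * Clearing a pole of a rational matrix *)

Section ClearedPole.
Variable F : fieldType.

(** The power of X - z in the reduced denominator is cancelled. When the order is exactly [nu] and
    positive, coprimality prevents the numerator from vanishing at [z]. *)
Lemma clear_pole_frac (f : {fraction {poly F}}) z nu : (rat_pole_order f z <= nu)%N ->
  exists p e : {poly F}, [/\ e.[z] != 0,
    (('X - z%:P) ^+ nu)%:F * f = p%:F / e%:F &
    rat_pole_order f z = nu -> (0 < nu)%N -> p.[z] != 0].
Proof.
set m := rat_pole_order f z => mnu.
have d0 := rat_den_neq0 f.
have mq : ('X - z%:P) ^+ m %| rat_den f by rewrite -mup_geq // leqnn.
have [e de] : exists e, rat_den f = e * ('X - z%:P) ^+ m.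
  by exists (rat_den f %/ ('X - z%:P) ^+ m); rewrite divpK.
have ez : e.[z] != 0.
  rewrite -rootE -dvdp_XsubCl; apply/negP => /dvdpP [e' ee'].
  have : (m < mup z (rat_den f))%N.
    by rewrite mup_geq // de ee' -mulrA -exprS dvdp_mull.
  by rewrite ltnn.
exists (('X - z%:P) ^+ (nu - m) * rat_num f), e; split=> //.
  have e0 : e != 0 by apply: contraNneq ez => ->; rewrite horner0.
  rewrite [in LHS](rat_num_den f) mulrA -tofracM; apply/eqP.
  rewrite eqr_div ?tofrac_eq0 // -!tofracM tofrac_eq; apply/eqP.
  rewrite de -{1}(subnK mnu) exprD.
  by move: (('X - z%:P) ^+ (nu - m)) (('X - z%:P) ^+ m) (rat_num f) => a b n; ring.
move=> mE nu0; rewrite mE subnn expr0 mul1r.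
apply/negP => nz; have := coprimep_rat_num_den f.
rewrite coprimep_sym => /coprimep_root h; have := h z; rewrite nz => /(_ _)/negP; case=> //.
rewrite de rootM; apply/orP; right; rewrite mE -(prednK nu0) exprS rootM root_XsubC eqxx //.
Qed.

Lemma clear_pole_eval d (A : 'M[{fraction {poly F}}]_d) (P : 'M[{poly F}]_d)
    (q : {poly F}) z w nu :
  (forall i j, A i j = (P i j)%:F / q%:F) -> q.[w] != 0 ->
  mx_eval (clear_pole A z nu) w = (w - z) ^+ nu *: mx_eval A w.
Proof.
move=> AE qw; apply/matrixP => i j; rewrite !mxE AE mulrA -tofracM !rat_eval_frac //.
by rewrite hornerM horner_exp hornerXsubC mulrA.
Qed.

Lemma common_denominator d (A : 'M[{fraction {poly F}}]_d) :
  exists (P : 'M[{poly F}]_d) (q : {poly F}),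
    q != 0 /\ forall i j, A i j = (P i j)%:F / q%:F.
Proof.
pose q := \prod_i \prod_j rat_den (A i j).
have q0 : q != 0.
  by apply/prodf_neq0 => i _; apply/prodf_neq0 => j _; apply: rat_den_neq0.
exists (\matrix_(i, j) (rat_num (A i j) * (q %/ rat_den (A i j)))), q.
split=> // i j; rewrite [LHS]rat_num_den mxE; apply/eqP.
rewrite eqr_div ?tofrac_eq0 ?rat_den_neq0 // -!tofracM tofrac_eq -mulrA divpK //.
by rewrite /q (bigD1 i) //= (bigD1 j) //= -mulrA dvdp_mulIl.
Qed.

Lemma det_numerator_neq0 d (A : 'M[{fraction {poly F}}]_d) (P : 'M[{poly F}]_d) (q : {poly F}) :
  A \in unitmx -> (forall i j, A i j = (P i j)%:F / q%:F) -> \det P != 0.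
Proof.
move=> Au AE; have -> : \det P != 0 = ((\det P)%:F != 0) by rewrite tofrac_eq0.
move: Au; rewrite unitmxE unitfE; apply: contraNneq => P0.
have -> : A = (q%:F)^-1 *: map_mx (@FracField.tofrac {poly F}) P.
  by apply/matrixP => i j; rewrite !mxE AE mulrC.
by rewrite detZ (etrans (det_map_mx _ _) P0) mulr0.
Qed.

End ClearedPole.

(** * Removable singularities *)

Section Main.
Variable R : realType.
Implicit Types z w : R[i].

Lemma poly_neq0_near (p : {poly R[i]}) z : p != 0 ->
  exists2 r : R, 0 < r & forall w, w != z -> nm (w - z) < r -> p.[w] != 0.
Proof.
move=> p0; have [s sE] := closed_field_poly_normal p.
have [r r0 hr] : exists2 r : R, 0 < r & forall a, a \in s -> a = z \/ r <= nm (a - z).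
  elim: s {sE} => [|a s [r r0 hr]]; first by exists 1.
  have [az|az] := eqVneq a z.
    by exists r => // b; rewrite inE => /orP[/eqP->|/hr//]; left.
  exists (Num.min r (nm (a - z))); first by rewrite lt_min r0 nm_gt0 subr_eq0.
  move=> b; rewrite inE => /orP[/eqP->|/hr [->|h]]; [right|by left|right].
    by rewrite ge_min lexx orbT.
  by rewrite ge_min h.
exists r => // w wz wr; rewrite sE hornerZ mulf_neq0 ?lead_coef_eq0 //.
rewrite horner_prod prodf_seq_neq0; apply/allP => a /hr sa /=.
rewrite hornerXsubC subr_eq0; apply/eqP => wa.
case: sa => [az|]; first by rewrite wa az eqxx in wz.
by rewrite -wa leNgt wr.
Qed.

Lemma mlim_clear_pole d (A : 'M[{fraction {poly R[i]}}]_d) z nu :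
  (mx_pole_order A z <= nu)%N ->
  mlim (mx_eval (clear_pole A z nu)) z (mx_eval (clear_pole A z nu) z).
Proof.
move=> Anu i j.
have [|p [e [ez pe _]]] := @clear_pole_frac _ (A i j) z nu.
  apply: leq_trans Anu; rewrite /mx_pole_order (leq_trans _ (leq_bigmax i)) //.
  exact: (leq_bigmax (F := fun j => rat_pole_order (A i j) z) j).
have E w : mx_eval (clear_pole A z nu) w i j = rat_eval (p%:F / e%:F) w.
  by rewrite !mxE -pe.
have e0 : e != 0 by apply: contraNneq ez => ->; rewrite horner0.
have [r r0 hr] := poly_neq0_near z e0.
rewrite E rat_eval_frac //.
apply: (@eq_plim _ (fun w => p.[w + 0] / e.[w + 0])).
  by apply/dnbhsCP; exists r => // w wz wr; rewrite E rat_eval_frac ?hr // addr0.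
rewrite -[in p.[z]](addr0 z) -[in e.[z]](addr0 z).
apply: plimM; first exact: plim_horner.
by apply: plimV; [rewrite addr0|exact: plim_horner].
Qed.

Lemma seq_Re_bound (s : seq R[i]) : exists lam : R, forall a, a \in s -> lam <= complex.Re a.
Proof.
elim: s => [|a s [lam h]]; first by exists 0.
exists (Num.min lam (complex.Re a)) => b; rewrite inE => /orP[/eqP->|/h hb].
  by rewrite ge_min lexx orbT.
by rewrite ge_min hb.
Qed.

(** The equation is known only on some punctured disc around each of z, z - 1, ..., z - n; these
    finitely many discs are translated to [z] and intersected. *)
Lemma solution_iter d (A : 'M[{fraction {poly R[i]}}]_d) Z z n : solution_on setT A Z ->
  exists2 r : R, 0 < r & forall w, w != z -> nm (w - z) < r ->
    Z (w + 1) = mx_eval A w *m \prod_(1 <= j < n.+1) mx_eval A (w - j%:R) *m Z (w - n%:R).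
Proof.
move=> Zsol; elim: n => [|n [r r0 hr]].
  have /dnbhsCP [r r0 hr] := Zsol z I I.
  exists r => // w wz wr; rewrite big_geq // mulmxE mulr1 subr0; exact: hr.
have /dnbhsCP [r' r'0 hr'] := Zsol (z - n.+1%:R) I I.
exists (Num.min r r'); first by rewrite lt_min r0.
move=> w wz; rewrite lt_min => /andP[wr wr'].
have e : w - n.+1%:R - (z - n.+1%:R) = w - z by rewrite opprD opprK addrACA addNr addr0.
have Zw : Z (w - n%:R) = mx_eval A (w - n.+1%:R) *m Z (w - n.+1%:R).
  rewrite -hr' ?e //; last by rewrite -subr_eq0 e subr_eq0.
  by congr Z; rewrite -natr1 opprD addrA subrK.
have -> : \prod_(1 <= j < n.+2) mx_eval A (w - j%:R) =
    \prod_(1 <= j < n.+1) mx_eval A (w - j%:R) *m mx_eval A (w - n.+1%:R).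
  by rewrite big_nat_recr.
by rewrite (hr w wz wr) Zw !mulmxA.
Qed.

Lemma removable_product_eq0 d (A : 'M[{fraction {poly R[i]}}]_d) zeta nu :
  A \in unitmx -> (0 < nu)%N -> mx_pole_order A zeta = nu ->
  (forall j : nat, (0 < j)%N -> ~ is_pole A (zeta - j%:R)) ->
  removable_r_singularity A zeta ->
  exists k : nat, (0 < k)%N /\
    mx_eval (clear_pole A zeta nu) zeta *m
      \prod_(1 <= j < k.+1) mx_eval A (zeta - j%:R) = 0.
Proof.
move=> Au nu0 Anu hleft [_ hrem].
have [P [q [q0 AE]]] := common_denominator A.
have P0 := det_numerator_neq0 Au AE.
have [rq qE] := closed_field_poly_normal q.
have [rb bE] := closed_field_poly_normal (\det P).
have lq0 : lead_coef q != 0 by rewrite lead_coef_eq0.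
have lb0 : lead_coef (\det P) != 0 by rewrite lead_coef_eq0.
have [lam hlam] := seq_Re_bound (rq ++ rb).
have rq_lam r : r \in rq -> lam <= complex.Re r by move=> h; rewrite hlam // mem_cat h.
have rb_lam r : r \in rb -> lam <= complex.Re r by move=> h; rewrite hlam // mem_cat h orbT.
have evalE z : q.[z] != 0 -> mx_eval A z = step_mx P q z.
  move=> qz; apply/matrixP => i j.
  by rewrite /step_mx !mxE AE rat_eval_frac // /horner_eval mulrC.
(* The successor makes [k] positive and exceed Re zeta - lam, which puts [c] strictly inside the
   half-plane. *)
pose k := (Num.truncn (complex.Re zeta - lam)).+1; pose c := zeta - k%:R.
have c_lam : half_plane lam c.
  by rewrite /half_plane ReD ReN Re_nat ltrBlDr -ltrBlDl truncnS_gt.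
exists k; split=> //.
set M := _ *m _; suff h (v : 'cV[R[i]]_d) : M *m v = 0.
  apply/matrixP => i j; have := h (delta_mx j (0 : 'I_1)).
  by rewrite -colE => /colP/(_ i); rewrite !mxE.
have [Y [Yhol Ysol [g g0 Yc]]] :=
  half_plane_solution v lq0 lb0 qE bE rq_lam rb_lam c_lam.
have [||Z [ZY _ Zsol Zhol]] := hrem lam Y.
- by move=> z hz i; apply: Yhol.
- move=> z hz hz1; have [r r0 hr] := Ysol z hz hz1.
  apply/dnbhsCP; exists r => // w wz wr; have [hw ->] := hr w wz wr.
  rewrite evalE //; apply: (denominator_neq0 lq0 qE (H := half_plane lam)) => // a /rq_lam ha.
  by rewrite /half_plane ltNge ha.
suff : M *m Y c = 0 by rewrite Yc -scalemxAr => /eqP; rewrite scaler_eq0 (negbTE g0) => /eqP.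
pose F w : 'cV[R[i]]_d := (w - zeta) ^+ nu *: Z (w + 1).
pose G w : 'cV[R[i]]_d := mx_eval (clear_pole A zeta nu) w *m
  \prod_(1 <= j < k.+1) mx_eval A (w - j%:R) *m Z (w - k%:R).
have limF : mlim F zeta 0.
  have -> : 0 = (0 : R[i]) *: Z (zeta + 1) by rewrite scale0r.
  apply: mlimZ.
    have -> : (0 : R[i]) = ('X^nu : {poly R[i]}).[zeta + - zeta] by rewrite hornerXn subrr expr0n gtn_eqF.
    have := @plim_horner R[i] 'X^nu zeta (- zeta); congr plim.
    by apply: funext => w; rewrite hornerXn.
  move=> i j; rewrite ord1; apply: (@plim_shift _ (fun w => Z w i 0)).
  by apply: derivable1_continuous; exact: nbhs_singleton (Zhol i).
have limG : mlim G zeta (M *m Y c).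
  apply: mlimM.
    apply: mlimM; first by apply: mlim_clear_pole; rewrite Anu.
    exact: mlim_prod_mx_eval.
  move=> i j; rewrite ord1.
  have : plim (fun w => Y (w - k%:R) i 0) zeta (Y c i 0).
    apply: (@plim_shift _ (fun w => Y w i 0)).
    by apply: derivable1_continuous; exact: nbhs_singleton (Yhol c i c_lam).
  (* For [w] this close to [zeta], [w - k] stays in the half-plane, where the continuation [Z]
     coincides with [Y]. *)
  apply: eq_plim; apply/dnbhsCP; exists (lam - complex.Re c); first by rewrite subr_gt0.
  move=> w _ wr; rewrite ZY //.
  have := le_lt_trans (ler_norm _) (le_lt_trans (Re_le_nm (w - zeta)) wr).
  by rewrite /left_half_plane /= /c !ReD !ReN => h; lra.
apply: (mlim_uniq limG); apply: eq_mlim limF.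
have [r r0 hr] := solution_iter zeta k Zsol.
have [r' r'0 hr'] := poly_neq0_near zeta q0.
apply/dnbhsCP; exists (Num.min r r'); first by rewrite lt_min r0.
move=> w wz; rewrite lt_min => /andP[wr wr'].
have scale3 (a : R[i]) (B C : 'M[R[i]]_d) (x y : 'cV[R[i]]_d) :
  y = B *m C *m x -> a *: y = (a *: B) *m C *m x by move=> ->; rewrite -!scalemxAl.
apply: etrans (scale3 _ _ _ _ _ (hr w wz wr)) _.
by rewrite -(clear_pole_eval zeta nu AE (hr' w wz wr')).
Qed.

End Main.

Theorem proposition4p1 (R : realType) (K : divringClosed R[i]) (d : nat)
    (A : 'M[{fraction {poly R[i]}}]_d) (hA : GL_rational_over K A)
    (zeta : R[i]) (nu : nat) (hnu : (1 <= nu)%N)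
    (hpole : mx_pole_order A zeta = nu)
    (hleft : forall j : nat, (0 < j)%N -> ~ is_pole A (zeta - j%:R)) :
  mx_eval (clear_pole A zeta nu) zeta <> 0 /\
  (removable_r_singularity A zeta ->
   (exists k : nat, (0 < k)%N /\
      mx_eval (clear_pole A zeta nu) zeta *m
        \prod_(1 <= j < k.+1) mx_eval A (zeta - j%:R) = 0) /\
   (exists j : nat, (0 < j)%N /\ \det (mx_eval A (zeta - j%:R)) = 0)).
Proof.
have Anz : mx_eval (clear_pole A zeta nu) zeta <> 0.
  (* An empty matrix has pole order 0, so [nu >= 1] gives d > 0 and the maximal order is attained by
     some entry. *)
  have d0 : (0 < #|'I_d|)%N.
    rewrite card_ord lt0n; apply: contraTneq hnu => d0; rewrite -hpole /mx_pole_order.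
    by rewrite big1 // => i; have := ltn_ord i; rewrite {2}d0.
  have [i hi] := @bigop.eq_bigmax 'I_d (fun i => \max_(j < d) rat_pole_order (A i j) zeta) d0.
  have [j hj] := @bigop.eq_bigmax 'I_d (fun j => rat_pole_order (A i j) zeta) d0.
  have ij : rat_pole_order (A i j) zeta = nu by rewrite -hj -hi.
  have [|p [e [ez pe pz]]] := @clear_pole_frac _ (A i j) zeta nu; first by rewrite ij.
  move=> /matrixP/(_ i j); rewrite !mxE pe rat_eval_frac // => /eqP.
  by rewrite mulf_eq0 invr_eq0 (negbTE ez) (negbTE (pz ij hnu)).
split=> // hrem.
have hk := removable_product_eq0 hA.1 hnu hpole hleft hrem; split=> //.
have [k [_ hk0]] := hk.
have [//|no] := pselect (exists j : nat, (0 < j)%N /\ \det (mx_eval A (zeta - j%:R)) = 0).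
(* If no factor were singular, the product could be cancelled and the cleared matrix would vanish at
   [zeta]. *)
case: Anz; have Pu : \prod_(1 <= j < k.+1) mx_eval A (zeta - j%:R) \in unitmx.
  rewrite unitmxE unitfE; elim: k {hk0} => [|n IH]; first by rewrite big_geq // det1 oner_eq0.
  rewrite big_nat_recr //= -mulmxE det_mulmx mulf_neq0 //.
  by apply/eqP => h; case: no; exists n.+1.
by rewrite -(mulmxK Pu (mx_eval (clear_pole A zeta nu) zeta)) hk0 mul0mx.
Qed.
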